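(* Let $\mathbf G$ be a compact metric graph with $\mathbf V_{end}\ne\emptyset$. For each $p>1$, let $u_p$ be a least energy solution of the Dirichlet--Kirchhoff Lane--Emden problem on $\mathbf G$, and let $x_p\in\mathbf G$ be a maximum point of $u_p$. Then $$\operatorname{dist}(x_p,M)\longrightarrow 0\qquad\text{as }p\to\infty.$$ In particular, if $M=\{a_*\}$, then $x_p\to a_*$ as $p\to\infty$.
   Context: Graphs. $\mathbf G=\mathbf G(\mathbf V,\mathbf E)$ is a graph with vertex set $\mathbf V$ and edge set $\mathbf E$; it is connected, has finitely many edges, contains no loops, and no vertex has degree $2$. It is a compact metric graph: each edge $\mathbf e$ is identified with an interval $[0,l(\mathbf e)]$ with $0<l(\mathbf e)<\infty$. $\operatorname{dist}$ is the shortest-path distance on $\mathbf G$. $\mathbf V_{int}$ is the set of vertices of degree $\ge 3$, $\mathbf V_{end}$ the set of vertices of degree $1$, and $\mathbf V=\mathbf V_{int}\sqcup\mathbf V_{end}$. Write $\mathbf e\succ\mathbf v$ if $\mathbf e$ is incident to $\mathbf v$. Function spaces. For a function $u$ on $\mathbf G$, $u^{(\mathbf e)}$ is its restriction to $\mathbf e$, $\nabla=\frac{d}{dx}$ and $\Delta=\frac{d^2}{dx^2}$ on each edge, and $\int_{\mathbf G}=\sum_{\mathbf e}\int_0^{l(\mathbf e)}$. $H^1(\mathbf G)$ is the space of continuous functions $u$ on $\mathbf G$ with $u^{(\mathbf e)}\in H^1(\mathbf e)$ for all $\mathbf e$, with norm $\|u\|_{H^1(\mathbf G)}^2=\int_{\mathbf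 G}(|\nabla u|^2+u^2)dx$; $H^1_0(\mathbf G)=\{u\in H^1(\mathbf G): u(\mathbf v)=0\ \forall \mathbf v\in\mathbf V_{end}\}$. Green function. For $y\in\mathbf G\setminus\mathbf V_{end}$, the Dirichlet--Kirchhoff Green function $G(\cdot,y)$ is the unique element of $H_0^1(\mathbf G)$ with $\int_{\mathbf G}\nabla_xG(x,y)\nabla\varphi(x)\,dx=\varphi(y)$ for all $\varphi\in H^1_0(\mathbf G)$; for $y\in\mathbf V_{end}$, $G(\cdot,y)=0$. Set $M=\{a\in\mathbf G: G(a,a)=\max_{x\in\mathbf G}G(x,x)\}$. Least energy solutions. Let $J_p(u)=\frac12\int_{\mathbf G}|\nabla u|^2dx-\frac1{p+1}\int_{\mathbf G}|u|^{p+1}dx$ and $\sigma_p=\inf_{u\in H^1_0(\mathbf G)\setminus\{0\}}\sup_{t>0}J_p(tu)$. The Dirichlet--Kirchhoff Lane--Emden problem is: $u$ continuous on $\mathbf G$; $-\Delta u^{(\mathbf e)}=(u^{(\mathbf e)})^p$ and $u^{(\mathbf e)}>0$ in (the interior of) each edge; $\sum_{\mathbf e\succ\mathbf v}\partial u^{(\mathbf e)}(\mathbf v)=0$ for each $\mathbf v\in\mathbf V_{int}$, where $\partial u^{(\mathbf e)}(\mathbf v)$ is the outward derivative at $\mathbf v$ along $\mathbf e$ (derivative in the direction pointing from $\mathbf v$ into $\mathbf e$); $u(\mathbf v)=0$ for each $\mathbf v\in\mathbf V_{end}$. A least energy solution is a (positive) solution $u_p$ of this problem with $J_p(u_p)=\sigma_p$;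 one exists for each $p>1$. *)

(* Defs.v *)
From HB Require Import structures.
From mathcomp Require Import all_boot all_order all_algebra.
From mathcomp Require Import all_classical all_reals all_analysis.

Set Implicit Arguments.
Unset Strict Implicit.
Unset Printing Implicit Defensive.

Import Order.TTheory GRing.Theory Num.Theory.
Import numFieldNormedType.Exports.

Local Open Scope classical_set_scope.
Local Open Scope ring_scope.

(* Parallel edges are allowed. The labels [src e], [tgt e] of the two ends of
   [e] only fix its identification with [0, len e], [src e] being at 0. *)
Record metric_graph (R : realType) := MetricGraph {
  vertex : finType;
  edge : finType;
  src : edge -> vertex;
  tgt : edge -> vertex;
  len : edge -> R;
  len_gt0 : forall e, 0 < len e;
  no_loop : forall e, src e != tgt e }.

Arguments src {R m} _.
Arguments tgt {R m} _.
Arguments len {R m} _.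

Section Combinatorics.
Context {R : realType} {G : metric_graph R}.
Implicit Types (e : edge G) (v w : vertex G).

(* [incident e v] is e \succ v *)
Definition incident e v := (src e == v) || (tgt e == v).

Definition degree v := #|[set e | incident e v]%SET|.

Definition Vint v := (3 <= degree v)%N.

Definition Vend v := degree v == 1%N.

Definition adjacent v w :=
  (v != w) && [exists e, incident e v && incident e w].

End Combinatorics.

Definition connected_graph (R : realType) (G : metric_graph R) :=
  forall v w : vertex G, connect adjacent v w.

Section Points.
Context {R : realType} (G : metric_graph R).

(* The points of the metric graph, each represented exactly once. *)
Inductive gpoint :=
  | Vertex of vertex G
  | Inner (e : edge G) (t : R) of 0 < t < len e.

(* The point of [e] at coordinate [t]; only used for 0 <= t <= len e. *)
Definition at_edge (e : edge G) (t : R) : gpoint :=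
  match boolP (0 < t < len e) with
  | AltTrue te => Inner te
  | AltFalse _ => Vertex (if t <= 0 then src e else tgt e)
  end.

(* [route x y d]: some path from [x] to [y], made of finitely many segments
   each contained in an edge, has length [d]. *)
Inductive route (x : gpoint) : gpoint -> R -> Prop :=
  | route_nil : route x x 0
  | route_step d e (s t : R) : 0 <= s <= len e -> 0 <= t <= len e ->
      route x (at_edge e s) d -> route x (at_edge e t) (d + `|t - s|).

Definition dist (x y : gpoint) : R := inf [set d | route x y d].

(* Extended-real-valued, so that the distance to the empty set is +oo. *)
Definition dist_set (x : gpoint) (A : set gpoint) : \bar R :=
  ereal_inf [set (dist x a)%:E | a in A].

Definition graph_continuous (u : gpoint -> R) :=
  forall x eps, 0 < eps -> exists2 delta, 0 < delta &
    forall y, dist x y < delta -> `|u x - u y| < eps.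

End Points.

Arguments Vertex {R G} _.

Section Sobolev_interval.
Context {R : realType}.
Notation mu := (@lebesgue_measure R).
Implicit Types (l : R) (f g phi : R -> R).

(* phi is in C^1_c(0, l) *)
Definition test_fun l phi :=
  [/\ forall t : R, derivable phi t 1, continuous (derive1 phi)
    & exists a b : R, [/\ 0 < a, b < l & forall t : R, ~~ (a <= t <= b) -> phi t = 0]].

Definition L2 l f := measurable_fun `[0, l] f /\
  mu.-integrable `[0, l] (fun t => ((f t) ^+ 2)%:E).

Definition weak_derivative l f g := L2 l g /\
  forall phi, test_fun l phi ->
    (\int[mu]_(t in `[0, l]) (f t * derive1 phi t) =
     - \int[mu]_(t in `[0, l]) (g t * phi t))%R.

Definition H1_interval l f := L2 l f /\ exists g, weak_derivative l f g.

(* A representative; any two agree almost everywhere on [0, l]. *)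
Definition weak_deriv l f : R -> R := xget (cst 0) [set g | weak_derivative l f g].

End Sobolev_interval.

Section FunctionSpaces.
Context {R : realType} {G : metric_graph R}.
Notation mu := (@lebesgue_measure R).
Implicit Types (u phi : gpoint G -> R) (e : edge G) (v : vertex G).

(* u^(e), to be considered on [0, len e] *)
Definition restr u e : R -> R := fun t => u (at_edge e t).

Definition grad u e : R -> R := weak_deriv (len e) (restr u e).

(* A function on G defined almost everywhere is a family of functions on the
   edges. *)
Definition int_graph (f : edge G -> R -> R) : R :=
  \sum_e \int[mu]_(t in `[0, len e]) f e t.

Definition H1 u :=
  graph_continuous u /\ forall e, H1_interval (len e) (restr u e).

Definition H10 u := H1 u /\ forall v, Vend v -> u (Vertex v) = 0.

Definition is_green (y : gpoint G) (g : gpoint G -> R) := H10 g /\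
  forall phi, H10 phi -> int_graph (fun e t => grad g e t * grad phi e t) = phi y.

Definition end_point (y : gpoint G) := if y is Vertex v then Vend v else false.

(* G(x, y); the Riesz theorem makes [is_green y] a singleton when y is not an
   end vertex, so the default value [cst 0] is not used. *)
Definition green (x y : gpoint G) : R :=
  if end_point y then 0 else xget (cst 0) [set g | is_green y g] x.

Definition green_argmax : set (gpoint G) :=
  [set a | forall x, green x x <= green a a].

Definition energy (p : R) u : R :=
  2^-1 * int_graph (fun e t => `|grad u e t| ^+ 2)
  - (p + 1)^-1 * int_graph (fun e t => `|restr u e t| `^ (p + 1)).

(* sigma_p, as an extended real so that no boundedness is presupposed. *)
Definition least_energy (p : R) : \bar R :=
  ereal_inf [set ereal_sup [set (energy p (fun x => t * u x))%:E | t in [set t | 0 < t]]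
            | u in [set u | H10 u /\ u <> cst 0]].

(* The edge [e] incident to [v], with coordinate the distance to [v] along [e]. *)
Definition at_edge_from v e (t : R) : gpoint G :=
  at_edge e (if src e == v then t else len e - t).

Definition is_outward_deriv u v e (d : R) :=
  (u (at_edge_from v e t) - u (Vertex v)) / t @[t --> 0^'+] --> d.

(* Existence of the outward derivatives is part of the condition. *)
Definition kirchhoff u v := exists d : edge G -> R,
  (forall e, incident e v -> is_outward_deriv u v e (d e)) /\
  \sum_(e | incident e v) d e = 0.

Definition lane_emden (p : R) u :=
  [/\ graph_continuous u,
      forall e (t : R), 0 < t < len e ->
        [/\ derivable (restr u e) t 1, derivable (derive1 (restr u e)) t 1,
            - derive1 (derive1 (restr u e)) t = (restr u e t) `^ p & 0 < restr u e t],
      forall v, Vint v -> kirchhoff u v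
    & forall v, Vend v -> u (Vertex v) = 0].

Definition least_energy_solution (p : R) u :=
  lane_emden p u /\ (energy p u)%:E = least_energy p.

Definition maximum_point u (x : gpoint G) := forall y, u y <= u x.

End FunctionSpaces.

Arguments green_argmax {R} G.
Arguments least_energy {R} G p.

(* Main.v *)
From HB Require Import structures.
Require Import Defs.
From mathcomp Require Import all_boot all_order all_algebra.
From mathcomp Require Import all_classical all_reals all_analysis.
From mathcomp Require Import measurable_realfun.
From mathcomp Require Import ring lra.

Import Order.TTheory GRing.Theory Num.Theory.
Import numFieldNormedType.Exports.

Local Open Scope classical_set_scope.
Local Open Scope ring_scope.

Set Implicit Arguments.
Unset Strict Implicit.
Unset Printing Implicit Defensive.

(** Why the maximum points concentrate on the maximum set of the Green diagonal.

    Write D(u) for the Dirichlet integral, m for the maximum of G(y, y) over the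
    graph, L for the total length and U for the maximum of the solution u_p,
    attained at x_p. Three estimates are played against each other.

    - Cauchy-Schwarz applied to D(G(., y), phi) = phi(y) gives
      phi(y)^2 <= G(y, y) D(phi) for every phi in H^1_0
      [green_diagonal_bound]; hence U^2 <= G(x_p, x_p) D(u_p).
    - Testing the equation with u_p gives D(u_p) = \int u_p^(p+1)
      [solution_energy_identity], so that the least energy is
      (1/2 - 1/(p+1)) D(u_p). The multiples of G(., a), where G(a, a) = m, are
      admissible in the infimum that defines it, and this yields
      limsup D(u_p) <= 1/m [dirichlet_limsup]: the p-dependence of
      \int G(., a)^(p+1) disappears in the limit because only the maximum of
      G(., a), which is m, survives the power 2/(p-1).
    - The same identity gives D(u_p) <= L U^(p-1) U^2 <= L U^(p-1) m D(u_p),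
      that is 1 <= L m U^(p-1), whence liminf U >= 1 [maximum_liminf].

    Together liminf G(x_p, x_p) >= m [green_maximum_point_liminf]. On each edge
    G(y, y) is a quadratic polynomial in the coordinate of y, so it is bounded
    away from m at a positive distance from the maximum set
    [green_far_from_argmax], which is the claim.

    Two foundations are laid first. Gradients are weak derivatives picked among
    all square-integrable ones, so they have to be identified: the integral of a
    weak derivative of a continuous function f over [a, b] is f b - f a
    [weak_derivative_increment], and therefore any two of them agree almost
    everywhere [weak_derivative_unique]. The Green function, as a chosen element
    of a set that has to be shown inhabited, is constructed by hand: it is affine
    on each edge except for a kink at the pole, and its values at the vertices
    solve a finite linear system [discrete_green], [pole_green_is_green]. *)

(** * Calculus on a closed interval *)
Section Interval.
Context {R : realType}.
Notation mu := (@lebesgue_measure R).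
Implicit Types (a b l t : R) (f g w k phi : R -> R).

(** Lets the arguments of the graph metric be transported to an edge, whose
    coordinate carries the subspace topology. *)
Lemma within_continuous_itvP a b f :
  {within `[a, b], continuous f} <->
  forall t, a <= t <= b -> forall eps : R, 0 < eps -> exists2 delta : R, 0 < delta &
    forall s, a <= s <= b -> `|t - s| < delta -> `|f t - f s| < eps.
Proof.
split=> [/subspace_continuousP cf t tab eps eps0|H].
  have := cf t; rewrite /= in_itv /= => /(_ tab) /cvgrPdist_lt /(_ _ eps0).
  rewrite near_withinE => /nbhs_ballP [d /= d0 dP]; exists d => // s sab ts.
  by apply: dP => //; rewrite /= in_itv.
apply/subspace_continuousP => t; rewrite /= in_itv /= => tab.
apply/cvgrPdist_lt => eps eps0; have [d d0 dP] := H _ tab _ eps0.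
rewrite near_withinE; apply/nbhs_ballP; exists d => //= s ts.
by rewrite in_itv /= => sab; apply: dP.
Qed.

Lemma within_continuous_subitv a b c d f : a <= c -> d <= b ->
  {within `[a, b], continuous f} -> {within `[c, d], continuous f}.
Proof.
by move=> ac db; apply: continuous_subspaceW; apply: subset_itv; rewrite bnd_simp.
Qed.

Lemma within_continuous_cvg_right a b f : a < b ->
  {within `[a, b], continuous f} -> f t @[t --> a^'+] --> f a.
Proof. by move=> ab /(continuous_within_itvP _ ab) []. Qed.

Lemma within_continuous_cvg_left a b f : a < b ->
  {within `[a, b], continuous f} -> f t @[t --> b^'-] --> f b.
Proof. by move=> ab /(continuous_within_itvP _ ab) []. Qed.

Lemma within_continuousM a b f g : {within `[a, b], continuous f} ->
  {within `[a, b], continuous g} -> {within `[a, b], continuous (fun t => f t * g t)}.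
Proof.
move=> /subspace_continuousP cf /subspace_continuousP cg.
by apply/subspace_continuousP => t tab; apply: cvgM; [exact: cf|exact: cg].
Qed.

Lemma measurable_itvR a b : measurable (`[a, b]%classic : set (measurableTypeR R)).
Proof. exact: measurable_itv. Qed.

Lemma integrable_itv_continuous a b f :
  {within `[a, b], continuous f} -> mu.-integrable `[a, b] (EFin \o f).
Proof. by move=> cf; apply: continuous_compact_integrable => //; exact: segment_compact. Qed.

Lemma measurable_itv_continuous a b f :
  {within `[a, b], continuous f} -> measurable_fun `[a, b] f.
Proof. by move=> cf; apply: subspace_continuous_measurable_fun. Qed.

Lemma integrable_subitv a b c d f : a <= c -> d <= b ->
  mu.-integrable `[a, b] (EFin \o f) -> mu.-integrable `[c, d] (EFin \o f).
Proof.
move=> ac db; apply: integrableS => //.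
by apply: subset_itv; rewrite bnd_simp.
Qed.

Lemma Rintegral_itv_cat c a b f : a <= c <= b ->
  mu.-integrable `[a, b] (EFin \o f) ->
  \int[mu]_(t in `[a, b]) f t =
  \int[mu]_(t in `[a, c]) f t + \int[mu]_(t in `[c, b]) f t.
Proof.
move=> /andP[ac cb] fi; apply/eqP; rewrite addrC -subr_eq; apply/eqP.
rewrite Rintegral_itvB ?bnd_simp //.
apply: Rintegral_itv_obnd_cbnd.
by apply: integrableS fi => //; apply: subset_itv; rewrite bnd_simp.
Qed.

Lemma Rintegral_itv_point a f : \int[mu]_(t in `[a, a]) f t = 0.
Proof. by rewrite set_itv1 Rintegral_set1. Qed.

(** [f] is of class C^1 up to the ends of [a, b] with derivative [w]; nothing is
    asked of [f] outside the interval, where an edge function is meaningless. *)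
Definition primitive_on a b f w :=
  [/\ {within `[a, b], continuous f}, {within `[a, b], continuous w}
    & forall t, a < t < b -> is_derive t 1 f (w t)].

Lemma primitive_on_subitv a b c d f w : a <= c -> d <= b ->
  primitive_on a b f w -> primitive_on c d f w.
Proof.
move=> ac db [cf cw fw]; split; [exact: within_continuous_subitv cf|
  exact: within_continuous_subitv cw|move=> t /andP[ct td]].
by apply: fw; rewrite (le_lt_trans ac ct) (lt_le_trans td db).
Qed.

Lemma primitive_on_derivable_oo a b f w : a < b -> primitive_on a b f w ->
  derivable_oo_LRcontinuous f a b.
Proof.
move=> ab [cf cw fw]; split.
- by move=> t; rewrite in_itv /= => /fw [].
- exact: within_continuous_cvg_right cf.
- exact: within_continuous_cvg_left cf.
Qed.

Lemma primitive_on_derive1 a b f w : primitive_on a b f w ->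
  {in `]a, b[, derive1 f =1 w}.
Proof.
by move=> [cf cw fw] t; rewrite in_itv /= derive1E => /fw H; rewrite derive_val.
Qed.

Lemma Rintegral_primitive_on a b f w : a <= b -> primitive_on a b f w ->
  \int[mu]_(t in `[a, b]) w t = f b - f a.
Proof.
rewrite le_eqVlt => /predU1P[->|ab] fw; first by rewrite Rintegral_itv_point subrr.
have [_ cw _] := fw.
rewrite /Rintegral (continuous_FTC2 ab cw (primitive_on_derivable_oo ab fw)) //.
exact: primitive_on_derive1 fw.
Qed.

Lemma Rintegral_by_parts_on a b f w g k : a <= b ->
  primitive_on a b f w -> primitive_on a b g k ->
  \int[mu]_(t in `[a, b]) (f t * k t) =
  f b * g b - f a * g a - \int[mu]_(t in `[a, b]) (w t * g t).
Proof.
rewrite le_eqVlt => /predU1P[->|ab] fw gk; first by rewrite !Rintegral_itv_point !subrr.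
have [_ cw _] := fw; have [_ ck _] := gk.
apply: Rintegration_by_parts => //; by
  [exact: primitive_on_derivable_oo fw|exact: primitive_on_derive1 fw|
   exact: primitive_on_derivable_oo gk|exact: primitive_on_derive1 gk].
Qed.

Lemma L2_continuous l f : {within `[0, l], continuous f} -> L2 l f.
Proof.
move=> cf; split; first exact: measurable_itv_continuous.
by apply: (integrable_itv_continuous (f := fun t => f t ^+ 2)); apply: within_continuousM.
Qed.

(** Since 2 |f g| <= f^2 + g^2. *)
Lemma L2_integrableM l f g : L2 l f -> L2 l g ->
  mu.-integrable `[0, l] (EFin \o (fun t => f t * g t)).
Proof.
move=> [mf f2] [mg g2].
have mI := measurable_itvR 0 l.
apply: (le_integrable mI _ _ (integrableD mI f2 g2)).
  exact/measurable_EFinP/measurable_funM.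
move=> t _ /=; rewrite lee_fin normrM [leRHS]ger0_norm ?addr_ge0 ?sqr_ge0 //.
rewrite -(real_normK (num_real (f t))) -(real_normK (num_real (g t))).
have := normr_ge0 (f t); have := normr_ge0 (g t); nra.
Qed.

Lemma L2_cst l (c : R) : L2 l (cst c).
Proof. by apply: L2_continuous; apply: continuous_subspaceT => t; exact: cvg_cst. Qed.

Lemma L2_integrable l f : L2 l f -> mu.-integrable `[0, l] (EFin \o f).
Proof.
move=> f2; have := L2_integrableM f2 (L2_cst l 1).
by congr (integrable _ _ (EFin \o _)); apply/funext => t; rewrite mulr1.
Qed.

Lemma L2Z l c f : L2 l f -> L2 l (fun t => c * f t).
Proof.
move=> f2; split; first by apply: measurable_funM => //; case: f2.
have := integrableZl (measurable_itvR 0 l) (c ^+ 2) f2.2.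
by congr (integrable _ _ _); apply/funext => t; rewrite -EFinM -exprMn.
Qed.

Lemma L2D l f g : L2 l f -> L2 l g -> L2 l (fun t => f t + g t).
Proof.
move=> f2 g2; have [mf f2i] := f2; have [mg g2i] := g2.
have mI := measurable_itvR 0 l.
split; first exact: measurable_funD.
have := integrableD mI (integrableD mI f2i (integrableZl mI 2 (L2_integrableM f2 g2))) g2i.
apply: eq_integrable => // t _ /=; rewrite -?EFinM -?EFinD; congr EFin.
by ring.
Qed.

(** * Weak derivatives on an interval *)

(** A first-order expansion with a uniform quadratic remainder also covers the
    points where two pieces of a C^1 function meet. *)
Lemma is_derive_quadratic f t (d C : R) :
  (forall h, `|f (t + h) - f t - d * h| <= C * h ^+ 2) -> is_derive t 1 f d.
Proof.
move=> H.
have cv : h^-1 *: (f (h *: (1 : R) + t) - f t) @[h --> 0^'] --> d.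
  apply/cvgrPdist_le => eps eps0.
  have C0 : 0 <= C by have := le_trans (normr_ge0 _) (H 1); rewrite expr1n mulr1.
  have C1 : 0 < C + 1 by lra.
  near=> h.
  have h0 : h != 0 by near: h; exact: nbhs_dnbhs_neq.
  rewrite /GRing.scale /= mulr1 [h + t]addrC distrC.
  have -> : h^-1 * (f (t + h) - f t) - d = h^-1 * (f (t + h) - f t - d * h).
    by field.
  rewrite normrM normfV ler_pdivrMl ?normr_gt0 //.
  apply: (le_trans (H h)).
  rewrite -(real_normK (num_real h)) expr2 mulrA mulrC ler_wpM2l //.
  have hC : `|h| <= eps / (C + 1).
    by near: h; apply: (@dnbhs0_le _ R^o); rewrite divr_gt0.
  rewrite ler_pdivlMr // in hC.
  have := normr_ge0 h; nra.
split; first by apply/cvg_ex; exists d.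
exact: cvg_lim cv.
Unshelve. all: by end_near.
Qed.

(** A C^1 ramp from 0 on the left of 0 to 1 on the right of 1, made of shifted
    squares of positive parts so that it is differentiated by one formula. Test
    functions close to indicators are differences of rescaled ramps. *)
Definition ramp t : R := 2 * Num.max 0 t ^+ 2
  - 4 * Num.max 0 (t - 2^-1) ^+ 2 + 2 * Num.max 0 (t - 1) ^+ 2.

(** The piecewise affine function of integral 1, supported in [0, 1], which is the
    derivative of [ramp]. *)
Definition hat t : R := 4 * Num.max 0 t
  - 8 * Num.max 0 (t - 2^-1) + 4 * Num.max 0 (t - 1).

Lemma ramp_le0 t : t <= 0 -> ramp t = 0.
Proof. by move=> t0; rewrite /ramp !max_l ?expr0n /=; lra. Qed.

Lemma ramp_ge1 t : 1 <= t -> ramp t = 1.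
Proof. by move=> t0; rewrite /ramp !max_r; [field|lra..]. Qed.

Lemma hat_le0 t : t <= 0 -> hat t = 0.
Proof. by move=> t0; rewrite /hat !max_l; lra. Qed.

Lemma hat_ge1 t : 1 <= t -> hat t = 0.
Proof. by move=> t0; rewrite /hat !max_r; lra. Qed.

Lemma hat_ge0 t : 0 <= hat t.
Proof.
by rewrite /hat !maxElt; do ![case: ltP => ?]; lra.
Qed.

Lemma continuous_hat : continuous hat.
Proof.
have cm c : continuous (fun s : R => Num.max 0 (s - c)).
  move=> t; apply: (@continuous_max R R (fun=> 0 : R^o) (fun s => s - c : R^o)).
    exact: cvg_cst.
  by apply: cvgB; [exact: cvg_id|exact: cvg_cst].
move=> t; have := cm 0 t; under eq_fun do rewrite subr0; move=> cm0.
by apply: cvgD; [apply: cvgB|]; apply: cvgM; rewrite ?subr0 //; exact: cvg_cst || exact: cm.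
Qed.

Lemma ramp_bound t : 0 <= ramp t <= 1.
Proof.
by rewrite /ramp !maxElt; do ![case: ltP => ?]; nra.
Qed.

Lemma is_derive_ramp t : is_derive t 1 ramp (hat t).
Proof.
apply: (@is_derive_quadratic _ _ _ 8) => h.
have sq x : `|Num.max 0 (x + h) ^+ 2 - Num.max 0 x ^+ 2 - 2 * Num.max 0 x * h| <= h ^+ 2.
  by rewrite ler_norml !maxElt; do ![case: ltP => ?]; apply/andP; split; nra.
have := sq t; have := sq (t - 2^-1); have := sq (t - 1).
rewrite /ramp /hat !ler_norml ![t + h - _]addrAC => /andP[? ?] /andP[? ?] /andP[? ?].
by apply/andP; split; lra.
Qed.

Lemma is_derive_step (m c : R) t :
  is_derive t 1 (fun s => ramp (m * (s - c))) (m * hat (m * (t - c))).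
Proof.
have d1 : is_derive t 1 (fun s : R => m * (s - c)) m.
  apply: is_derive_eq; rewrite subr0 /GRing.scale /=; ring.
have d2 := is_derive_ramp (m * (t - c)).
rewrite mulrC.
exact: (@is_derive1_comp R ramp (fun s : R => m * (s - c)) t _ m d2 d1).
Qed.

Lemma continuous_bump (m c : R) : continuous (fun s => m * hat (m * (s - c))).
Proof.
move=> t; apply: cvgM; first exact: cvg_cst.
apply: (@continuous_comp _ _ _ (fun s : R => m * (s - c)) hat); last exact: continuous_hat.
by apply: cvgM; [exact: cvg_cst|apply: cvgB; [exact: cvg_id|exact: cvg_cst]].
Qed.

Lemma primitive_on_step a b (m c : R) :
  primitive_on a b (fun s => ramp (m * (s - c))) (fun s => m * hat (m * (s - c))).
Proof.
split; last by move=> t _; exact: is_derive_step.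
  by apply: continuous_subspaceT => t; apply: differentiable_continuous;
    apply/derivable1_diffP; case: (is_derive_step m c t).
apply: continuous_subspaceT; exact: continuous_bump.
Qed.

(** The rescaled hats have total mass 1, so they average [f] over their support. *)
Lemma approximate_identity l f (m c y eps : R) :
  {within `[0, l], continuous f} -> 0 < m -> 0 <= c -> c + m^-1 <= l ->
  (forall s, c <= s <= c + m^-1 -> `|f s - y| <= eps) ->
  `|\int[mu]_(t in `[0, l]) (f t * (m * hat (m * (t - c)))) - y| <= eps.
Proof.
move=> cf m_gt0 c0 cl fy.
have mV : 0 < m^-1 by rewrite invr_gt0.
have l0 : 0 <= l by lra.
have pr := primitive_on_step 0 l m c; have [_ cb _] := pr.
have Ib : \int[mu]_(t in `[0, l]) (m * hat (m * (t - c))) = 1.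
  rewrite (Rintegral_primitive_on l0 pr) ramp_ge1 ?ramp_le0 ?subr0 //.
    by rewrite pmulr_rle0 //; lra.
  by rewrite -ler_pdivrMl // mulr1; lra.
have b0 s : 0 <= m * hat (m * (s - c)) by rewrite mulr_ge0 ?hat_ge0 // ltW.
have bs s : ~~ (c <= s <= c + m^-1) -> m * hat (m * (s - c)) = 0.
  rewrite negb_and -!ltNge => /orP[sc|sc].
    by rewrite hat_le0 ?mulr0 // pmulr_rle0 //; lra.
  by rewrite hat_ge1 ?mulr0 // -ler_pdivrMl // mulr1; lra.
have ib := integrable_itv_continuous cb.
have ifb := integrable_itv_continuous (within_continuousM cf cb).
have mI := measurable_itvR 0 l.
have cmp r : \int[mu]_(t in `[0, l]) (r * (m * hat (m * (t - c)))) = r.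
  by rewrite RintegralZl // Ib mulr1.
have ir r : mu.-integrable `[0, l] (EFin \o (fun t => r * (m * hat (m * (t - c))))).
  by have := integrableZl mI r ib.
rewrite ler_distl -[in X in X && _](cmp (y - eps)) -[in X in _ && X](cmp (y + eps)).
apply/andP; split; apply: le_Rintegral => // t _;
  case: (boolP (c <= t <= c + m^-1)) => [ct|/bs ->]; rewrite ?mulr0 //;
  by apply: ler_wpM2r => //; move: (fy _ ct); rewrite ler_distl => /andP[].
Qed.

(** Test the definition with a function [phi n] that rises from 0 to 1 just after
    [a] and falls back just before [b]. Its derivative is a difference of two
    approximate identities, so one side tends to [f a - f b]; the other tends to
    minus the integral of [g] by dominated convergence. *)
Lemma weak_derivative_increment l f g a b :
  {within `[0, l], continuous f} -> weak_derivative l f g ->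
  0 <= a -> a <= b -> b <= l -> \int[mu]_(t in `[a, b]) g t = f b - f a.
Proof.
move=> cf [g2 wg] a0; rewrite le_eqVlt => /predU1P[->|ab] bl.
  by rewrite Rintegral_itv_point subrr.
have l0 : 0 <= l by lra.
have mI := measurable_itvR 0 l.
have gi := L2_integrable g2.
have [m mE] : exists m : nat -> R, forall n, m n = n.+1%:R by exists (fun n => n.+1%:R).
have m0 n : 0 < m n by rewrite mE ltr0n.
(* The two ramps occupy [a + 1/m, a + 2/m] and [b - 2/m, b - 1/m], so that the
   support stays inside the open interval even when a = 0 or b = l. *)
pose up n t := ramp (m n * (t - (a + (m n)^-1))).
pose down n t := ramp (m n * (t - (b - (m n)^-1 * 2))).
pose dup n t := m n * hat (m n * (t - (a + (m n)^-1))).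
pose ddown n t := m n * hat (m n * (t - (b - (m n)^-1 * 2))).
pose phi n t := up n t - down n t.
have m_large (r : R) : 0 < r -> \forall n \near \oo, (m n)^-1 <= r.
  move=> r0; near=> n; rewrite -ler_pV2 ?inE ?unitf_gt0 ?invr_gt0 //= invrK.
  rewrite mE (@le_trans _ _ n%:R) ?ler_nat //; near: n; exact: nbhs_infty_ger.
have dphi n t : is_derive t 1 (phi n) (dup n t - ddown n t).
  by apply: is_deriveB; exact: is_derive_step.
have derphi n : derive1 (phi n) = (fun t => dup n t - ddown n t).
  by apply/funext => t; rewrite derive1E derive_val.
have cdup n : continuous (dup n) /\ continuous (ddown n).
  by split; apply: continuous_bump.
have cphi n : continuous (phi n).
  by move=> t; apply: differentiable_continuous; apply/derivable1_diffP; case: (dphi n t).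
have upE1 n t : a + (m n)^-1 * 2 <= t -> up n t = 1.
  by move=> h; rewrite /up ramp_ge1 // -ler_pdivrMl // mulr1; lra.
have upE0 n t : t <= a + (m n)^-1 -> up n t = 0.
  by move=> h; rewrite /up ramp_le0 // pmulr_rle0 //; lra.
have downE1 n t : b - (m n)^-1 <= t -> down n t = 1.
  by move=> h; rewrite /down ramp_ge1 // -ler_pdivrMl // mulr1; lra.
have downE0 n t : t <= b - (m n)^-1 * 2 -> down n t = 0.
  by move=> h; rewrite /down ramp_le0 // pmulr_rle0 //; lra.
have mV n : 0 < (m n)^-1 by rewrite invr_gt0.
have test : \forall n \near \oo, test_fun l (phi n).
  near=> n.
  have small : (m n)^-1 <= (b - a) / 4 by near: n; apply: m_large; lra.
  split.
  - by move=> t; case: (dphi n t).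
  - rewrite derphi => t; have [c1 c2] := cdup n.
    by apply: cvgB; [exact: c1|exact: c2].
  - exists (a + (m n)^-1), (b - (m n)^-1); split; [have := mV n; lra..|].
    move=> t; rewrite negb_and -!ltNge /phi => /orP[h|h].
      by rewrite upE0 ?downE0 ?subrr //; have := mV n; lra.
    by rewrite upE1 ?downE1 ?subrr //; have := mV n; lra.
pose I n := \int[mu]_(t in `[0, l]) (g t * phi n t).
have cvI : I n @[n --> \oo] --> \int[mu]_(t in `[a, b]) g t.
  have -> : \int[mu]_(t in `[a, b]) g t = \int[mu]_(t in `[0, l]) ((g \_ `]a, b[) t).
    rewrite -Rintegral_itv_bndo_bndc; last first.
      by apply: integrableS gi => //; apply: subset_itv; rewrite bnd_simp.
    rewrite -Rintegral_itv_obnd_cbnd; last first.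
      by apply: integrableS gi => //; apply: subset_itv; rewrite bnd_simp.
    rewrite -Rintegral_mkcondr //; congr Rintegral.
    rewrite setIidr //; apply: subset_itv; rewrite bnd_simp //.
  have ig : mu.-integrable `[0, l] (EFin \o (g \_ `]a, b[)).
    have -> : EFin \o (g \_ `]a, b[) = (EFin \o g) \_ `]a, b[.
      by apply/funext => t; rewrite /patch /=; case: ifP.
    apply/(integrable_restrict mu) => //; apply: integrableS gi => //.
    by rewrite setIidr //; apply: subset_itv; rewrite bnd_simp.
  (* The sequence is eventually constant at every point. *)
  have cvt (t : R) : (g t * phi n t)%:E @[n --> \oo] --> ((g \_ `]a, b[) t)%:E.
    apply: cvg_near_cst.
    have [/andP[at_ tb]|tab] := boolP (a < t < b).
      near=> n; rewrite patchE mem_set /= ?in_itv /= ?at_ //.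
      have la : (m n)^-1 <= (t - a) / 2 by near: n; apply: m_large; lra.
      have lb : (m n)^-1 <= (b - t) / 2 by near: n; apply: m_large; lra.
      by rewrite /phi upE1 ?downE0 ?subr0 ?mulr1 //; clear - la lb; lra.
    near=> n; rewrite patchE memNset /= ?in_itv /=; last exact/negP.
    have small : (m n)^-1 <= (b - a) / 4 by near: n; apply: m_large; lra.
    have h' : (t <= a) || (b <= t) by move: (tab); rewrite negb_and -!leNgt.
    rewrite (_ : point = 0) //; have := mV n; case/orP: h' => h h''.
      by rewrite /phi upE0 ?downE0 ?subrr ?mulr0 //; clear - small h h'' ab; lra.
    by rewrite /phi upE1 ?downE1 ?subrr ?mulr0 //; clear - small h h'' ab; lra.
  apply: fine_cvg; rewrite fineK; last exact: integrable_fin_num.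
  apply: (@dominated_cvg _ _ _ mu _ mI _ _ (fun t => `|g t|%:E)).
  - move=> n; apply/measurable_EFinP/measurable_funM; first by case: g2.
    apply: measurable_funTS; exact: continuous_measurable_fun.
  - by move=> t _; exact: cvt.
  - by [].
  - by apply: integrable_norm.
  - move=> n t _; rewrite lee_fin normrM ler_piMr //.
    have := ramp_bound (m n * (t - (a + (m n)^-1))).
    have := ramp_bound (m n * (t - (b - (m n)^-1 * 2))).
    by rewrite /phi /up /down ler_norml; move=> /andP[? ?] /andP[? ?]; apply/andP; split; lra.
apply: (@cvg_unique _ (@norm_hausdorff _ R^o) _ _ _ _ cvI).
apply/cvgrPdist_le => eps eps0.
have [al bI] : 0 <= a <= l /\ 0 <= b <= l by split; lra.
have half0 : 0 < eps / 2 by rewrite divr_gt0.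
have [da da0 Pa] := (within_continuous_itvP 0 l f).1 cf a al _ half0.
have [db db0 Pb] := (within_continuous_itvP 0 l f).1 cf b bI _ half0.
near=> n.
have small : (m n)^-1 <= (b - a) / 4 by near: n; apply: m_large; lra.
have smalla : (m n)^-1 <= da / 3 by near: n; apply: m_large; lra.
have smallb : (m n)^-1 <= db / 3 by near: n; apply: m_large; lra.
have tn : test_fun l (phi n) by near: n.
have h := mV n.
have ua : `|\int[mu]_(t in `[0, l]) (f t * dup n t) - f a| <= eps / 2.
  apply: approximate_identity => // [||s hs].
  - by rewrite addr_ge0 // ltW.
  - clear - small h ab bl; lra.
  - by rewrite distrC ltW // Pa ?ltr_norml; clear - hs h smalla small ab bl a0; lra.
have ub : `|\int[mu]_(t in `[0, l]) (f t * ddown n t) - f b| <= eps / 2.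
  apply: approximate_identity => // [||s hs].
  - clear - small h ab a0; lra.
  - clear - h bl; lra.
  - by rewrite distrC ltW // Pb ?ltr_norml; clear - hs h smallb small ab bl a0; lra.
have [cu cd] := cdup n.
have iu := integrable_itv_continuous (within_continuousM cf (continuous_subspaceT cu)).
have id := integrable_itv_continuous (within_continuousM cf (continuous_subspaceT cd)).
have EI : I n = \int[mu]_(t in `[0, l]) (f t * ddown n t)
              - \int[mu]_(t in `[0, l]) (f t * dup n t).
  apply: oppr_inj; rewrite -(wg _ tn) derphi opprB -RintegralB //.
  by apply: eq_Rintegral => t _; rewrite mulrBr.
move: ua ub; rewrite EI => /ler_normlP[ua1 ua2] /ler_normlP[ub1 ub2].
by rewrite ler_norml; clear - ua1 ua2 ub1 ub2; apply/andP; split; lra.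
Unshelve. all: by end_near.
Qed.

(** At a Lebesgue point [g] is the derivative of its indefinite integral, here 0. *)
Lemma ae_eq0_of_increments l g : mu.-integrable `[0, l] (EFin \o g) ->
  (forall a, 0 <= a <= l -> \int[mu]_(t in `[0, a]) g t = 0) ->
  \forall t \ae mu, `[0, l]%classic t -> g t = 0.
Proof.
move=> gi g0; pose G : R -> R := g \_ `[0, l].
have mI := measurable_itvR 0 l.
have locG : locally_integrable [set: R] G by apply: integrable_locally.
have GE t : 0 <= t <= l -> G t = g t.
  by move=> tl; rewrite /G patchE mem_set //= in_itv.
have Gi : mu.-integrable `[0, l] (EFin \o G).
  apply: eq_integrable gi => // t; rewrite inE /= in_itv /= => tl.
  by rewrite GE.
have pt (c : R) : mu.-negligible [set c].
  by exists [set c]; split => //; exact: lebesgue_measure_set1.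
have n0 : \forall t \ae mu, t <> (0 : R).
  by apply: negligibleS (pt 0) => t /= /contrapT.
have nl : \forall t \ae mu, t <> l.
  by apply: negligibleS (pt l) => t /= /contrapT.
have leb := lebesgue_differentiation locG.
suff key (t : R) : t <> 0 -> t <> l -> lebesgue_pt G t -> 0 <= t <= l -> g t = 0.
  apply: (@filterS3 _ _ (ae_filter_ringOfSetsType mu) _ _ _ _ _ n0 nl leb) => t t0 tl lt.
  by rewrite /= in_itv /=; exact: key.
move=> t0 tl lt /andP[t0' tl'].
have {}t0 : 0 < t by rewrite lt_neqAle t0' andbT eq_sym; apply/eqP.
have {}tl : t < l by rewrite lt_neqAle tl' andbT; apply/eqP.
have t0b : (BLeft (0%R : R) < BRight t)%E by rewrite lte_fin.
have [_ /= dG] := FTC1_lebesgue_pt tl Gi t0b lt.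
rewrite -GE ?(ltW t0) ?(ltW tl) // -dG derive1E.
rewrite (@near_eq_derive _ _ _ _ (cst 0)) ?derive_cst //.
have tI : t \in `]0, l[ by rewrite in_itv /= t0.
near=> s.
have : s \in `]0, l[ by near: s; exact: near_in_itvoo.
rewrite in_itv /= => /andP[s0 sl] /=.
rewrite -[RHS](g0 s) ?(ltW s0) ?(ltW sl) //; apply: eq_Rintegral => r.
rewrite inE /= in_itv /= => /andP[r0 rs]; rewrite GE // r0 /=.
by rewrite (le_trans rs) // ltW.
Unshelve. all: by end_near.
Qed.

Lemma ae_eq_Rintegral l f g h : L2 l f -> L2 l g -> L2 l h ->
  (\forall t \ae mu, `[0, l]%classic t -> f t = g t) ->
  \int[mu]_(t in `[0, l]) (f t * h t) = \int[mu]_(t in `[0, l]) (g t * h t).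
Proof.
move=> [mf _] [mg _] [mh _] fg; rewrite /Rintegral; congr fine.
apply: ae_eq_integral => //; try by apply/measurable_EFinP; apply: measurable_funM.
by apply: (@filterS _ _ (ae_filter_ringOfSetsType mu) _ _ _ fg) => t E It; rewrite E.
Qed.

Lemma weak_derivative_unique l f g1 g2 : {within `[0, l], continuous f} ->
  weak_derivative l f g1 -> weak_derivative l f g2 ->
  \forall t \ae mu, `[0, l]%classic t -> g1 t = g2 t.
Proof.
move=> cf w1 w2; have [L1 _] := w1; have [L2' _] := w2.
have L2n : L2 l (fun t => - 1 * g2 t) by exact: L2Z.
have mI := measurable_itvR 0 l.
have H : \forall t \ae mu, `[0, l]%classic t -> g1 t + - 1 * g2 t = 0.
  apply: ae_eq0_of_increments.
    exact: L2_integrable (L2D L1 L2n).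
  move=> a /andP[a0 al].
  have sub g : L2 l g -> mu.-integrable `[0, a] (EFin \o g).
    by move=> gL; apply: integrable_subitv (L2_integrable gL).
  rewrite RintegralD ?RintegralZl //; try exact: sub.
  rewrite (weak_derivative_increment cf w1) ?(weak_derivative_increment cf w2) //.
  by rewrite mulN1r subrr.
by apply: (@filterS _ _ (ae_filter_ringOfSetsType mu) _ _ _ H) => t E /E; rewrite mulN1r => /subr0_eq.
Qed.

Lemma weak_derivP l f : H1_interval l f -> weak_derivative l f (weak_deriv l f).
Proof. by move=> [_ [g wg]]; exact: (xgetI (cst 0) wg). Qed.

Lemma primitive_on_test a b l phi : test_fun l phi -> primitive_on a b phi (derive1 phi).
Proof.
move=> [dphi cphi _]; split; last by move=> t _; apply: DeriveDef; rewrite ?derive1E.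
  apply: continuous_subspaceT => t; apply: differentiable_continuous.
  exact/derivable1_diffP.
exact: continuous_subspaceT.
Qed.

Lemma test_fun0 l phi : test_fun l phi -> phi 0 = 0 /\ phi l = 0.
Proof.
by move=> [_ _ [a [b [a0 bl H]]]]; split; apply: H; rewrite negb_and -!ltNge ?a0 ?bl ?orbT.
Qed.

(** Two branches joined at [s]: the derivative of a function with a kink at [s]. *)
Definition glue (s : R) w1 w2 : R -> R := fun t => if t < s then w1 t else w2 t.

Lemma Rintegral_glue l (s : R) w1 w2 : 0 <= s <= l ->
  mu.-integrable `[0, s] (EFin \o w1) -> mu.-integrable `[s, l] (EFin \o w2) ->
  mu.-integrable `[0, l] (EFin \o glue s w1 w2) /\
  \int[mu]_(t in `[0, l]) glue s w1 w2 t =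
  \int[mu]_(t in `[0, s]) w1 t + \int[mu]_(t in `[s, l]) w2 t.
Proof.
move=> /andP[s0 sl] c1 i2.
have U : `[0, l]%classic = `[0, s[%classic `|` `[s, l]%classic :> set R.
  apply/seteqP; split=> t /=; rewrite !in_itv /=.
    by move=> /andP[-> ->]; case: ltP => _; [left|right].
  by move=> [] /andP[h1 h2]; apply/andP; split; lra.
have dj : [disjoint `[0%R, s[%classic & `[s, l]%classic].
  by apply/disj_setPS => t [] /=; rewrite !in_itv /= => /andP[_ ts] /andP[st _]; lra.
have i1 : mu.-integrable `[0, s[ (EFin \o w1).
  by apply: integrableS c1 => //; apply: subset_itv; rewrite bnd_simp.
have g1 t : t \in `[0, s[%classic -> glue s w1 w2 t = w1 t.
  by rewrite inE /= in_itv /= /glue => /andP[_ ->].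
have g2 t : t \in `[s, l]%classic -> glue s w1 w2 t = w2 t.
  by rewrite inE /= in_itv /= /glue ltNge => /andP[-> _].
have ig1 : mu.-integrable `[0, s[ (EFin \o glue s w1 w2).
  by apply: eq_integrable i1 => // t /g1 /= ->.
have ig2 : mu.-integrable `[s, l] (EFin \o glue s w1 w2).
  by apply: eq_integrable i2 => // t /g2 /= ->.
have ig : mu.-integrable `[0, l] (EFin \o glue s w1 w2).
  have /integrableP[m1 f1] := ig1; have /integrableP[m2 f2] := ig2.
  have mg : measurable_fun (`[0, s[ `|` `[s, l]) (EFin \o glue s w1 w2).
    exact/measurable_funU.
  rewrite U; apply/integrableP; split => //.
  rewrite ge0_integral_setU //; first exact: lte_add_pinfty.
  exact: measurableT_comp.
split => //.
rewrite U Rintegral_setU //; last by rewrite -U.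
congr (_ + _); last by apply: eq_Rintegral => t /g2.
by rewrite -Rintegral_itv_bndo_bndc //; apply: eq_Rintegral => t /g1.
Qed.

Lemma L2_glue l (s : R) w1 w2 : 0 <= s <= l ->
  {within `[0, s], continuous w1} -> {within `[s, l], continuous w2} ->
  L2 l (glue s w1 w2).
Proof.
move=> sl c1 c2; have ic := integrable_itv_continuous.
have [ig _] := Rintegral_glue sl (ic _ _ _ c1) (ic _ _ _ c2); split.
  by apply/measurable_EFinP; case/integrableP: ig.
have [ig2 _] := Rintegral_glue sl (ic _ _ _ (within_continuousM c1 c1))
  (ic _ _ _ (within_continuousM c2 c2)).
apply: eq_integrable ig2 => // t _ /=; rewrite /glue.
by case: ifP; rewrite expr2.
Qed.

(** Integrate by parts on both sides of the kink; the boundary terms at [s] cancel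
    because the two pieces agree there, those at the ends because test functions
    vanish there. *)
Lemma weak_derivative_glue l (s : R) f f1 f2 w1 w2 : 0 <= s <= l ->
  {within `[0, l], continuous f} ->
  (forall t, 0 <= t <= s -> f t = f1 t) -> (forall t, s <= t <= l -> f t = f2 t) ->
  primitive_on 0 s f1 w1 -> primitive_on s l f2 w2 ->
  weak_derivative l f (glue s w1 w2).
Proof.
move=> sl cf e1 e2 p1 p2; have [s0 sl'] := andP sl.
have [c1 d1 _] := p1; have [c2 d2 _] := p2; split; first exact: L2_glue.
move=> phi tphi; have [phi0 phil] := test_fun0 tphi.
have q1 := primitive_on_test 0 s tphi; have q2 := primitive_on_test s l tphi.
have [k1 _ _] := q1; have [k2 _ _] := q2.
have [_ cd _] := primitive_on_test 0 l tphi.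
rewrite (Rintegral_itv_cat sl); last exact: integrable_itv_continuous (within_continuousM cf cd).
have -> : \int[mu]_(t in `[0, s]) (f t * derive1 phi t) =
          \int[mu]_(t in `[0, s]) (f1 t * derive1 phi t).
  by apply: eq_Rintegral => t; rewrite inE /= in_itv /= => /e1 ->.
have -> : \int[mu]_(t in `[s, l]) (f t * derive1 phi t) =
          \int[mu]_(t in `[s, l]) (f2 t * derive1 phi t).
  by apply: eq_Rintegral => t; rewrite inE /= in_itv /= => /e2 ->.
rewrite (Rintegral_by_parts_on s0 p1 q1) (Rintegral_by_parts_on sl' p2 q2).
have ic := integrable_itv_continuous.
have [_ E] := Rintegral_glue sl (ic _ _ _ (within_continuousM d1 k1))
  (ic _ _ _ (within_continuousM d2 k2)).
have -> : \int[mu]_(t in `[0, l]) (glue s w1 w2 t * phi t) =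
  \int[mu]_(t in `[0, s]) (w1 t * phi t) + \int[mu]_(t in `[s, l]) (w2 t * phi t).
  by rewrite -E; apply: eq_Rintegral => t _; rewrite /glue; case: ifP.
have <- : f1 s = f2 s by rewrite -e1 -?e2 ?lexx ?s0.
by rewrite phi0 phil; ring.
Qed.

Lemma primitive_on_weak_derivative l f w : 0 <= l -> primitive_on 0 l f w ->
  weak_derivative l f w.
Proof.
move=> l0 p; have [cf _ _] := p.
have ll : 0 <= l <= l by rewrite l0 lexx.
have -> : w = glue l w w by apply/funext => t; rewrite /glue if_same.
by apply: (@weak_derivative_glue _ _ _ f f) => //; apply: primitive_on_subitv p.
Qed.

Lemma primitive_on_affine a b (c d : R) : primitive_on a b (fun t => c + d * t) (cst d).
Proof.
have D (t : R) : is_derive t 1 (fun t => c + d * t) d.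
  by apply: is_derive_eq; rewrite /GRing.scale /=; ring.
split=> //; apply: continuous_subspaceT => t; last exact: cvg_cst.
by apply: differentiable_continuous; apply/derivable1_diffP; case: (D t).
Qed.

Lemma weak_derivativeZ l (c : R) (f g : R -> R) : L2 l f -> weak_derivative l f g ->
  weak_derivative l (fun t => c * f t) (fun t => c * g t).
Proof.
move=> Lf [Lg wg]; split=> [|phi tphi]; first exact: L2Z.
have [cphi cdphi _] := primitive_on_test 0 l tphi.
have mI := measurable_itvR 0 l.
have i1 := L2_integrableM Lf (L2_continuous cdphi).
have i2 := L2_integrableM Lg (L2_continuous cphi).
transitivity (c * \int[mu]_(t in `[0, l]) (f t * derive1 phi t)).
  by rewrite -(RintegralZl c mI i1); apply: eq_Rintegral => t _; rewrite mulrA.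
rewrite wg // mulrN -(RintegralZl c mI i2); congr (- _).
by apply: eq_Rintegral => t _; rewrite mulrA.
Qed.

End Interval.

(** * Inequalities for real powers and quadratic polynomials *)
Section RealInequalities.
Context {R : realType}.
Implicit Types (x y p : R).

Lemma powR_predM p x : 0 < x -> x `^ (p - 1) * x = x `^ p.
Proof.
by move=> x0; rewrite -[in X in _ * X = _](powRr1 (ltW x0)) -powRD ?subrK // (gt_eqF x0) implybT.
Qed.

(** The graph of a convex function lies above its tangents. With r = y / x this is
    the inequality of Bernoulli, p r <= r `^ p + p - 1, which is Young's inequality
    for the product r * 1. *)
Lemma powR_tangent p x y : 1 <= p -> 0 < x -> 0 <= y ->
  x `^ p + p * x `^ (p - 1) * (y - x) <= y `^ p.
Proof.
rewrite le_eqVlt => /predU1P[<-|p1] x0 y0.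
  by rewrite subrr powRr0 !powRr1 ?(ltW x0) //; lra.
have p0 : 0 < p by lra.
have q0 : 0 < p / (p - 1) by rewrite divr_gt0 // subr_gt0.
have r0 : 0 <= y / x by rewrite divr_ge0 // ltW.
have pq : p^-1 + (p / (p - 1))^-1 = 1 by rewrite invf_div; field; rewrite gt_eqF.
have := conjugate_powR r0 ler01 p0 q0 pq.
rewrite powR1 mulr1 => H.
have yE : y = y / x * x by rewrite divfK // gt_eqF.
have xp : 0 < x `^ p by rewrite powR_gt0.
have E := powR_predM p x0.
rewrite [in leRHS]yE powRM // ?(ltW x0) //.
have -> : p * x `^ (p - 1) * (y - x) = p * (y / x - 1) * x `^ p.
  by rewrite -E {1}yE; ring.
rewrite -[X in X + _]mul1r -mulrDl ler_pM2r //.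
move: H; move: (y / x) ((y / x) `^ p) => r s H.
move: H; rewrite -[r <= _ + _](ler_pM2l p0).
have -> : p * (s / p + 1 / (p / (p - 1))) = s + (p - 1).
  by field; apply/andP; split; rewrite gt_eqF // subr_gt0.
by lra.
Qed.

(** By the tangent at the larger of the two points; in contrast to the mean value
    theorem this covers 0. *)
Lemma powR_lipschitz p x y m : 1 <= p -> 0 <= x <= m -> 0 <= y <= m ->
  `|x `^ p - y `^ p| <= p * m `^ (p - 1) * `|x - y|.
Proof.
move=> p1; wlog xy : x y / y <= x.
  move=> H hx hy; have [yx|/ltW xy] := leP y x; first exact: H.
  by rewrite distrC [`|x - y|]distrC; exact: H.
move=> /andP[x0 xm] /andP[y0 ym].
have p0 : 0 <= p by lra.
have m0 : 0 <= m by lra.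
rewrite !ger0_norm ?subr_ge0 ?ge0_ler_powR ?nnegrE //.
have [xE|xn0] := eqVneq x 0.
  have -> : y = x by lra.
  by rewrite !subrr mulr0.
have xgt : 0 < x by rewrite lt_neqAle eq_sym xn0.
have := powR_tangent p1 xgt y0.
have xmp : x `^ (p - 1) <= m `^ (p - 1) by rewrite ge0_ler_powR ?nnegrE //; lra.
have d0 : 0 <= p * (x - y) by rewrite mulr_ge0 // subr_ge0.
by nra.
Qed.

Lemma powR_large (b K : R) : 1 < b -> exists P : R, forall q, P < q -> K < b `^ q.
Proof.
move=> b1; exists (Num.max 1 (K / (b - 1))) => q; rewrite gt_max => /andP[q1 qK].
have b0 : 0 <= b by lra.
have := powR_tangent (ltW q1) ltr01 b0; rewrite !powR1 mulr1.
have d0 : 0 < b - 1 by lra.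
move: qK; rewrite ltr_pdivrMr // => h; apply: lt_le_trans; lra.
Qed.

(** The Cauchy-Schwarz argument: take r = a / c. If c = 0 the linear function
    2 r a of r is bounded above, so a = 0. *)
Lemma discriminant_bound (a c d : R) : 0 <= c -> 0 <= d ->
  (forall r, 2 * r * a <= r ^+ 2 * c + d) -> a ^+ 2 <= c * d.
Proof.
move=> c0 d0 Y; have [cE|cn] := eqVneq c 0.
  rewrite cE mul0r; have [->|a0] := eqVneq a 0; first by rewrite expr0n.
  have := Y ((d + 1) / (2 * a)); rewrite cE mulr0 add0r.
  have -> : 2 * ((d + 1) / (2 * a)) * a = d + 1 by field.
  by lra.
have cp : 0 < c by rewrite lt_neqAle eq_sym cn.
have := Y (a / c).
have -> : 2 * (a / c) * a = 2 * (a ^+ 2 / c) by field.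
have -> : (a / c) ^+ 2 * c = a ^+ 2 / c by field.
by move=> H; rewrite mulrC -ler_pdivrMr //; lra.
Qed.

(** Since (1 - z)^4 >= 1 - 8 z; turns the relative losses accumulated in the final
    estimate into the prescribed absolute one. *)
Lemma quartic_loss (z m d : R) : 0 < z -> z <= 2^-1 -> 0 < m -> z * (8 * m) <= d ->
  m - d <= (1 - z) * (m * (1 - z) ^+ 3).
Proof.
move=> h3 h2 h4 h1.
have -> : (1 - z) * (m * (1 - z) ^+ 3) = m - m * z * (4 - 6 * z + 4 * z ^+ 2 - z ^+ 3) by ring.
rewrite lerD2l lerN2.
have : 4 - 6 * z + 4 * z ^+ 2 - z ^+ 3 <= 8 by nra.
have : 0 <= m * z by rewrite mulr_ge0 // ltW.
nra.
Qed.

End RealInequalities.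

(** * Solutions of the equation on one edge *)
Section Solutions.
Context {R : realType}.
Notation mu := (@lebesgue_measure R).
Implicit Types (a b l t p : R) (f g w k phi : R -> R).

Lemma within_continuous_powR l f p : 1 <= p -> {within `[0, l], continuous f} ->
  (forall t, 0 <= t <= l -> 0 <= f t) ->
  {within `[0, l], continuous (fun t => f t `^ p)}.
Proof.
move=> p1 cf f0; apply/within_continuous_itvP => t tl eps eps0.
pose m := f t + 1; pose C := p * m `^ (p - 1).
have m0 : 0 < m by rewrite /m ltr_wpDl // f0.
have C0 : 0 < C by rewrite mulr_gt0 ?powR_gt0 //; lra.
have e0 : 0 < Num.min 1 (eps / C) by rewrite lt_min ltr01 divr_gt0.
have [d d0 dP] := (within_continuous_itvP 0 l f).1 cf t tl _ e0.
exists d => // s sl ts; have := dP s sl ts; rewrite lt_min => /andP[h1 h2].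
have ft := f0 t tl; have fs := f0 s sl.
have fsm : f s <= m by move: h1; rewrite ltr_norml /m => /andP[? _]; lra.
apply: (@le_lt_trans _ _ (C * `|f t - f s|)); last by rewrite mulrC -ltr_pdivlMr.
by apply: powR_lipschitz => //; rewrite ?ft ?fs //= /m; lra.
Qed.

(** Powers with real exponents are only well behaved on nonnegative numbers, and the
    equation gives the sign of the solution only inside the edge. *)
Lemma nonneg_on_closed_itv l f : 0 < l -> {within `[0, l], continuous f} ->
  (forall t, 0 < t < l -> 0 < f t) -> forall t, 0 <= t <= l -> 0 <= f t.
Proof.
move=> l0 cf pos t tl; rewrite leNgt; apply/negP => ft.
have eps0 : 0 < - f t by rewrite oppr_gt0.
have [d d0 dP] := (within_continuous_itvP 0 l f).1 cf t tl _ eps0.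
suff [s sl ts] : exists2 s, 0 < s < l & `|t - s| < d.
  have [s0 s1] := andP sl; have fs := pos s sl.
  have := dP s; rewrite (ltW s0) (ltW s1) => /(_ isT ts).
  by rewrite ltr_norml; clear - fs ft; lra.
have [e e0 [e1 e2]] : exists2 e, 0 < e & e < d /\ e < l / 2.
  exists (Num.min d l / 3); first by rewrite divr_gt0 // lt_min d0.
  have [h1 h2] : Num.min d l <= d /\ Num.min d l <= l by rewrite !ge_min !lexx orbT.
  by clear - d0 l0 h1 h2; split; lra.
have [th|th] := leP t (l / 2).
  by exists (t + e); rewrite ?ltr_norml; clear - tl th e0 e1 e2; lra.
by exists (t - e); rewrite ?ltr_norml; clear - tl th e0 e1 e2; lra.
Qed.

(** A function that solves the equation on the open edge and is continuous on
    the closed one is C^1 up to the ends: its derivative differs by a constant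
    from the integral of the continuous function [- f `^ p]. *)
Lemma primitive_on_solution l f p : 0 < l -> 1 <= p ->
  {within `[0, l], continuous f} ->
  (forall t, 0 < t < l -> [/\ derivable f t 1, derivable (derive1 f) t 1,
     - derive1 (derive1 f) t = f t `^ p & 0 < f t]) ->
  exists w, primitive_on 0 l f w /\ primitive_on 0 l w (fun t => - f t `^ p).
Proof.
move=> l0 p1 cf sol.
have f0 := nonneg_on_closed_itv l0 cf (fun t tl => let: And4 _ _ _ h := sol t tl in h).
pose k t := - f t `^ p.
have ck : {within `[0, l], continuous k}.
  move=> t; apply: cvgN; exact: (within_continuous_powR p1 cf f0).
have ik := integrable_itv_continuous ck.
pose W t := \int[mu]_(s in `[0, t]) k s.
have cW : {within `[0, l], continuous W}.
  exact: (parameterized_integral_continuous (ltW l0) ik).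
have dW t : 0 < t < l -> is_derive t 1 W (k t).
  move=> /andP[t0 tl].
  have ct : {for t, continuous k}.
    by apply: (within_continuous_continuous l0 ck); rewrite in_itv /= t0.
  have [dv dE] := continuous_FTC1_closed tl ik t0 ct.
  by apply: DeriveDef; [exact: dv|rewrite -derive1E; exact: dE].
pose v t := derive1 f t - W t.
have dv t : 0 < t < l -> is_derive t 1 v 0.
  move=> tl; have [_ d2 E _] := sol t tl; have := dW t tl.
  have d2' : is_derive t 1 (derive1 f) (k t).
    by apply: DeriveDef => //; rewrite -derive1E /k -E opprK.
  by move=> dWt; have := is_deriveB d2' dWt; rewrite subrr.
have [c vc] : exists c, forall t, 0 < t < l -> v t = c.
  have vlt x y : 0 < x -> x < y -> y < l -> v y = v x.
    move=> x0 xy yl.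
    have vI z : z \in `[x, y] -> is_derive z 1 v ((fun=> 0 : R) z).
      rewrite in_itv /= => /andP[xz zy]; apply: dv.
      by rewrite (lt_le_trans x0 xz) (le_lt_trans zy yl).
    have [|z _ /eqP] := MVT xy (fun z h => vI z (subset_itv_oo_cc h)).
      by apply: derivable_within_continuous => z /vI [].
    by rewrite mul0r subr_eq0 => /eqP.
  exists (v (l / 2)) => t /andP[t0 tl].
  have lh : 0 < l / 2 < l by clear - l0; lra.
  have [h1 h2] := andP lh.
  by have [th|th|->//] := ltgtP t (l / 2); [rewrite (vlt t (l / 2))|rewrite (vlt _ t h1)].
exists (fun t => c + W t); split.
  split => //.
    apply: within_continuousD => // t; exact: cvg_cst.
  move=> t tl; have [d1 _ _ _] := sol t tl.
  by apply: DeriveDef => //; rewrite -(vc t tl) /v subrK derive1E.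
split => //; first by apply: within_continuousD => // t; exact: cvg_cst.
by move=> t tl; have := is_deriveD (is_derive_cst c t 1) (dW t tl); rewrite add0r.
Qed.
End Solutions.

(** * Points, routes and distance *)
Section Graph.
Context {R : realType} {G : metric_graph R}.
Implicit Types (e : edge G) (v w : vertex G) (x y z : gpoint G).

Lemma at_edge_src e : at_edge e 0 = Vertex (src e).
Proof.
rewrite /at_edge; case: {-}_ / boolP => [h|h]; last by rewrite lexx.
by have := h; rewrite ltxx.
Qed.

Lemma at_edge_tgt e : at_edge e (len e) = Vertex (tgt e).
Proof.
rewrite /at_edge; case: {-}_ / boolP => [h|h]; last by rewrite leNgt len_gt0.
by have := h; rewrite ltxx andbF.
Qed.

Lemma at_edge_inner e t (te : 0 < t < len e) : at_edge e t = Inner te.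
Proof.
rewrite /at_edge; case: {-}_ / boolP => [h|]; last by rewrite te.
by rewrite (bool_irrelevance h te).
Qed.

Lemma incident_exists : connected_graph G -> (exists v, Vend v) ->
  forall v, exists e, incident e v.
Proof.
move=> Gc [a a1] v; have [->|va] := eqVneq v a.
  move: a1; rewrite /Vend /degree => /cards1P[e eE].
  by exists e; have := set11 e; rewrite -eE inE.
have /connectP[[|w s] /=] := Gc v a; first by move=> _ aE; rewrite aE eqxx in va.
by move=> /andP[/andP[_ /existsP[e /andP[ev _]]] _] _; exists e.
Qed.

(** Every vertex lies on an edge, since a connected graph with an end vertex has no
    isolated vertex. All statements about points are thus reduced to edges. *)
Lemma gpoint_at_edge : connected_graph G -> (exists v, Vend v) ->
  forall x, exists e t, 0 <= t <= len e /\ x = at_edge e t.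
Proof.
move=> Gc Ge [v|e t te].
  have [e /orP[/eqP<-|/eqP<-]] := incident_exists Gc Ge v.
    by exists e, 0; rewrite lexx ltW ?len_gt0 // at_edge_src.
  by exists e, (len e); rewrite lexx ltW ?len_gt0 // at_edge_tgt.
exists e, t; rewrite (at_edge_inner te); case/andP: (te) => t0 tl.
by rewrite !ltW.
Qed.

Lemma route_trans x y z (c d : R) : route x y c -> route y z d -> route x z (c + d).
Proof.
move=> xy; elim=> [|d' e s t hs ht _ IH]; first by rewrite addr0.
by rewrite addrA; exact: route_step.
Qed.

Lemma route_edge e s t : 0 <= s <= len e -> 0 <= t <= len e ->
  route (at_edge e s) (at_edge e t) `|t - s|.
Proof. by move=> hs ht; rewrite -[X in route _ _ X]add0r; apply: route_step => //; exact: route_nil. Qed.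

Lemma route_ge0 x y (d : R) : route x y d -> 0 <= d.
Proof. by elim=> // d' e s t _ _ _ h; rewrite addr_ge0. Qed.

Let end0 e : 0 <= (0 : R) <= len e. Proof. by rewrite lexx ltW ?len_gt0. Qed.
Let endl e : 0 <= len e <= len e. Proof. by rewrite lexx ltW ?len_gt0. Qed.

Lemma route_incident e v w : incident e v -> incident e w ->
  exists d, route (Vertex v) (Vertex w) d.
Proof.
by move=> /orP[/eqP<-|/eqP<-] /orP[/eqP<-|/eqP<-]; rewrite -?at_edge_src -?at_edge_tgt;
  eexists; apply: route_edge.
Qed.

Lemma route_vertices : connected_graph G ->
  forall v w, exists d, route (Vertex v) (Vertex w) d.
Proof.
move=> Gc v w; have /connectP[s] := Gc v w.
elim: s v => [v _ ->|a s IH v /= /andP[va ps] wE]; first by exists 0; exact: route_nil.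
have [d rd] := IH a ps wE; have /andP[_ /existsP[e /andP[ev ea]]] := va.
have [c rc] := route_incident ev ea.
by exists (c + d); exact: route_trans rc rd.
Qed.

Lemma route_exists : connected_graph G -> (exists v, Vend v) ->
  forall x y, exists d, route x y d.
Proof.
move=> Gc Ge x y.
have [e [s [hs ->]]] := gpoint_at_edge Gc Ge x.
have [e' [t [ht ->]]] := gpoint_at_edge Gc Ge y.
have [d rd] := route_vertices Gc (src e) (src e').
have := route_edge hs (end0 e); rewrite at_edge_src => r1.
have := route_edge (end0 e') ht; rewrite at_edge_src => r2.
by eexists; exact: route_trans (route_trans r1 rd) r2.
Qed.

Lemma dist_le_route x y (d : R) : route x y d -> dist x y <= d.
Proof.
by move=> r; apply: ge_inf => //; exists 0 => c /=; exact: route_ge0.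
Qed.

Lemma dist_ge0 x y : 0 <= dist x y.
Proof.
rewrite /dist; have [->|/set0P ne] := eqVneq [set d | route x y d] set0.
  by rewrite inf0.
by apply: lb_le_inf => // d /=; exact: route_ge0.
Qed.

Lemma dist_edge e s t : 0 <= s <= len e -> 0 <= t <= len e ->
  dist (at_edge e s) (at_edge e t) <= `|t - s|.
Proof. by move=> hs ht; apply/dist_le_route/route_edge. Qed.

(** The infimum of the empty set is 0, so the existence of a route between any two
    points is what makes a small distance meaningful. *)
Lemma dist_lt_route x y (c : R) : connected_graph G -> (exists v, Vend v) ->
  dist x y < c -> exists2 d, route x y d & d < c.
Proof.
move=> Gc Ge xy; have [d0 r0] := route_exists Gc Ge x y.
have hi : has_inf [set d | route x y d].
  by split; [exists d0|exists 0 => d /=; exact: route_ge0].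
have e0 : 0 < c - dist x y by rewrite subr_gt0.
have [d rd dE] := inf_adherent e0 hi; exists d => //.
by move: dE; rewrite -/(dist x y) addrC subrK.
Qed.

(** The Lipschitz bound on the edges adds up along routes. *)
Lemma graph_continuous_lipschitz (u : gpoint G -> R) (K : R) :
  connected_graph G -> (exists v, Vend v) ->
  (forall e s t, 0 <= s <= len e -> 0 <= t <= len e ->
     `|u (at_edge e s) - u (at_edge e t)| <= K * `|s - t|) ->
  graph_continuous u.
Proof.
move=> Gc Ge H.
have Hr x y d : route x y d -> `|u x - u y| <= K * d.
  elim=> [|d' e s t hs ht _ IH]; first by rewrite subrr normr0 mulr0.
  rewrite -(subrKA (u (at_edge e s))) mulrDr; apply: (le_trans (ler_normD _ _)).
  by rewrite lerD // distrC; exact: H.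
have K1 : 0 < Num.max K 0 + 1 by rewrite ltr_wpDl // le_max lexx orbT.
move=> x eps eps0; exists (eps / (Num.max K 0 + 1)); first exact: divr_gt0.
move=> y xy; have [d rd dd] := dist_lt_route Gc Ge xy.
apply: (le_lt_trans (Hr _ _ _ rd)).
have d0 := route_ge0 rd; move: dd; rewrite ltr_pdivlMr // mulrC.
apply: le_lt_trans; apply: ler_wpM2r => //.
by rewrite (@le_trans _ _ (Num.max K 0)) ?lerDl // le_max lexx.
Qed.

Lemma restr_continuous (u : gpoint G -> R) e : graph_continuous u ->
  {within `[0, len e], continuous (restr u e)}.
Proof.
move=> cu; apply/within_continuous_itvP => t tl eps eps0.
have [d d0 dP] := cu (at_edge e t) eps eps0; exists d => // s sl ts.
by apply: dP; apply: le_lt_trans ts; rewrite distrC; exact: dist_edge.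
Qed.

End Graph.

(** * The linear system for the vertex values of the Green function *)
Section DiscreteGreen.
Context {R : realType} {G : metric_graph R}.
Implicit Types (e : edge G) (v w : vertex G) (h phi : vertex G -> R).

Definition vdiff h e := h (tgt e) - h (src e).

(** The Dirichlet integral of the two functions that are affine on each edge and take
    the given values at the vertices. *)
Definition conductance_form h phi := \sum_e vdiff h e * vdiff phi e / len e.

(** Expand [phi] in the basis of indicator functions of vertices. *)
Lemma conductance_form_delta h phi :
  conductance_form h phi =
  \sum_w phi w * conductance_form h (fun w' => (w' == w)%:R).
Proof.
rewrite /conductance_form; under [RHS]eq_bigr do rewrite mulr_sumr.
rewrite exchange_big /=; apply: eq_bigr => e _.
have E (x : vertex G) : phi x = \sum_w phi w * (x == w)%:R.
  by rewrite (bigD1 x) //= eqxx mulr1 big1 ?addr0 // => w /negPf; rewrite eq_sym => ->; rewrite mulr0.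
rewrite /vdiff {1}(E (tgt e)) (E (src e)) -sumrB mulr_sumr mulr_suml.
by apply: eq_bigr => w _; ring.
Qed.

(** A function of zero energy is constant along edges, hence everywhere, and an end
    vertex forces the constant to be 0. *)
Lemma conductance_form_eq0 h : connected_graph G -> (exists v, Vend v) ->
  (forall v, Vend v -> h v = 0) -> conductance_form h h = 0 -> forall v, h v = 0.
Proof.
move=> Gc [a a1] h0 /eqP; rewrite psumr_eq0 => [/allP H|e _]; last first.
  by rewrite divr_ge0 ?(ltW (len_gt0 e)) // -expr2 sqr_ge0.
have he e : h (tgt e) = h (src e).
  have := H e (mem_index_enum e); rewrite /= !mulf_eq0 invr_eq0 (gt_eqF (len_gt0 e)) orbF orbb.
  by rewrite subr_eq0 => /eqP.
move=> v; rewrite -(h0 a a1); have /connectP[s ps ->] := Gc v a.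
elim: s v ps => //= w s IH v /andP[/andP[_ /existsP[e /andP[ev ew]]] ps].
rewrite -(IH w ps).
by move: ev ew => /orP[/eqP<-|/eqP<-] /orP[/eqP<-|/eqP<-]; rewrite ?he.
Qed.

(** The system for the vertex values of the Green function has as many equations
    as unknowns, so that it is solvable because its energy form is definite. *)
Lemma discrete_green : connected_graph G -> (exists v, Vend v) ->
  exists H : vertex G -> vertex G -> R,
    (forall v w, Vend w -> H v w = 0) /\
    forall v phi, (forall w, Vend w -> phi w = 0) ->
      conductance_form (H v) phi = phi v.
Proof.
move=> Gc Ge; pose V := {ffun vertex G -> R^o}.
pose T (h : V) : V := [ffun v => if Vend v then h v
  else conductance_form h (fun w => (w == v)%:R)].
(* The rows of T are the boundary conditions at the end vertices and the balance
   of fluxes at the others. *)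
have Tlin : linear T.
  move=> c h k; apply/ffunP => v; rewrite !ffunE; case: ifP => // _.
  rewrite /conductance_form scaler_sumr -big_split /=; apply: eq_bigr => e _.
  by rewrite /vdiff !ffunE /GRing.scale /=; ring.
pose TL : {linear V -> V} := HB.pack T (GRing.isLinear.Build _ _ _ _ T Tlin).
have TE (h : V) : linfun TL h = T h by rewrite lfunE.
have ker : lker (linfun TL) == 0%VS.
  apply/eqP/vspaceP => h; rewrite memv_ker memv0 TE; apply/eqP/eqP => [Th|->]; last first.
    by rewrite -TE linear0.
  have Thv v : T h v = 0 by rewrite Th ffunE.
  have h0 v : Vend v -> h v = 0 by move=> ve; have := Thv v; rewrite ffunE ve.
  apply/ffunP => v; rewrite ffunE; apply: (conductance_form_eq0 Gc Ge h0).
  rewrite conductance_form_delta big1 // => w _.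
  have := Thv w; rewrite ffunE; case: ifP => [we _|_ ->]; last by rewrite mulr0.
  by rewrite h0 // mul0r.
have solve (b : V) : exists h : V, T h = b.
  have : b \in limg (linfun TL) by rewrite (lker0_limgf ker) memvf.
  by move=> /memv_imgP[h _ ->]; exists h; rewrite TE.
have /choice[H HE] : forall v, exists h : V,
    T h = [ffun w => if Vend w then 0 else (w == v)%:R].
  by move=> v; exact: solve.
have HEv v w := congr1 (fun h : V => h w) (HE v).
exists (fun v => H v); split=> [v w we|v phi phi0].
  by have := HEv v w; rewrite !ffunE we.
rewrite conductance_form_delta.
have E w : phi w * conductance_form (H v) (fun w' => (w' == w)%:R) = phi w * (w == v)%:R.
  have [we|we] := boolP (Vend w); first by rewrite phi0 // !mul0r.
  by have := HEv v w; rewrite !ffunE (negPf we) => ->.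
under eq_bigr do rewrite E.
by rewrite (bigD1 v) //= eqxx mulr1 big1 ?addr0 // => w /negPf ->; rewrite mulr0.
Qed.

End DiscreteGreen.

(** * The Dirichlet form *)
Section Dirichlet.
Context {R : realType} {G : metric_graph R}.
Notation mu := (@lebesgue_measure R).
Implicit Types (e : edge G) (u phi psi : gpoint G -> R) (x y : gpoint G).

Lemma H10_continuous phi e : H10 phi -> {within `[0, len e], continuous (restr phi e)}.
Proof. by move=> [[c _] _]; exact: restr_continuous. Qed.

Lemma H10_grad phi e : H10 phi -> weak_derivative (len e) (restr phi e) (grad phi e).
Proof. by move=> [[_ H] _]; apply: weak_derivP. Qed.

Lemma H10_grad_L2 phi e : H10 phi -> L2 (len e) (grad phi e).
Proof. by move=> /(H10_grad e)[]. Qed.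

(** The only access to the chosen gradient: inside integrals it may be replaced by
    any weak derivative at hand. *)
Lemma Rintegral_grad phi e w k : H10 phi ->
  weak_derivative (len e) (restr phi e) w -> L2 (len e) k ->
  \int[mu]_(t in `[0, len e]) (grad phi e t * k t) =
  \int[mu]_(t in `[0, len e]) (w t * k t).
Proof.
move=> hphi ww Lk; apply: ae_eq_Rintegral => //; first exact: H10_grad_L2.
  by case: ww.
apply: weak_derivative_unique ww; [exact: H10_continuous|exact: H10_grad].
Qed.

Definition dirichlet phi psi := int_graph (fun e t => grad phi e t * grad psi e t).

Lemma dirichletC phi psi : dirichlet phi psi = dirichlet psi phi.
Proof.
by apply: eq_bigr => e _; apply: eq_Rintegral => t _; rewrite mulrC.
Qed.

Lemma dirichlet_ge0 phi : 0 <= dirichlet phi phi.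
Proof.
by apply: sumr_ge0 => e _; apply: Rintegral_ge0 => t _; rewrite -expr2 sqr_ge0.
Qed.

(** Integrate 0 <= (r phi' - psi')^2. *)
Lemma dirichlet_young phi psi (r : R) : H10 phi -> H10 psi ->
  2 * r * dirichlet phi psi <= r ^+ 2 * dirichlet phi phi + dirichlet psi psi.
Proof.
move=> hphi hpsi; rewrite /dirichlet /int_graph !mulr_sumr -big_split /=.
apply: ler_sum => e _.
have L1 := H10_grad_L2 e hphi; have L2' := H10_grad_L2 e hpsi.
have mI := measurable_itvR 0 (len e).
have i11 := L2_integrableM L1 L1; have i12 := L2_integrableM L1 L2'.
have i22 := L2_integrableM L2' L2'.
have iZ c (f : R -> R) : mu.-integrable `[0, len e] (EFin \o f) ->
   mu.-integrable `[0, len e] (EFin \o (fun t => c * f t)).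
  by move=> fi; have := integrableZl mI c fi.
rewrite -(RintegralZl (2 * r) mI i12) -(RintegralZl (r ^+ 2) mI i11).
rewrite -(RintegralD mI (iZ (r ^+ 2) _ i11) i22).
apply: le_Rintegral => //; first exact: iZ.
  by have := integrableD mI (iZ (r ^+ 2) _ i11) i22.
move=> t _; move: (grad phi e t) (grad psi e t) => a b; clear.
by rewrite -subr_ge0; have -> : r ^+ 2 * (a * a) + b * b - 2 * r * (a * b) = (r * a - b) ^+ 2;
  [ring|exact: sqr_ge0].
Qed.

Lemma green_cauchy_schwarz y g phi : is_green y g -> H10 phi ->
  phi y ^+ 2 <= g y * dirichlet phi phi.
Proof.
move=> [hg gE] hphi.
have gg : dirichlet g g = g y by rewrite -gE.
have gphi : dirichlet g phi = phi y by rewrite -gE.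
have g0 : 0 <= g y by rewrite -gg dirichlet_ge0.
have D0 := dirichlet_ge0 phi.
have Y r := dirichlet_young r hg hphi; rewrite gg gphi in Y.
exact: discriminant_bound.
Qed.

End Dirichlet.

(** * Construction of the Green function *)
Section ExplicitGreen.
Context {R : realType} {G : metric_graph R}.
Notation mu := (@lebesgue_measure R).
Implicit Types (e : edge G) (v w : vertex G) (x y : gpoint G) (phi : gpoint G -> R).
Context (Gc : connected_graph G) (Ge : exists v : vertex G, Vend v).
Context (H : vertex G -> vertex G -> R) (H0 : forall v w, Vend w -> H v w = 0).
Context (HE : forall v (phi : vertex G -> R), (forall w, Vend w -> phi w = 0) ->
  conductance_form (H v) phi = phi v).

(* the pole, at coordinate [s] of the edge [e0] *)
Context (e0 : edge G) (s : R) (s_in : 0 <= s <= len e0).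

(** The Green function with pole at the coordinate [s] has the vertex values of the
    barycentre of those with poles at the two ends of [e0], because the pole acts
    on functions that are affine along [e0] by interpolation. *)
Definition pole_vertex_value v : R :=
  (1 - s / len e0) * H (src e0) v + s / len e0 * H (tgt e0) v.

(** On the edges without pole the two slopes agree and the place of the break is
    arbitrary; it makes one formula serve all edges. *)
Definition breakpoint e : R := if e == e0 then s else 0.

(** The vertex values contribute their affine interpolation; the pole adds the tent
    over [0, len e0] that vanishes at both ends and whose slope drops by 1 at
    [s]. *)
Definition slope_before e : R :=
  vdiff pole_vertex_value e / len e + (if e == e0 then 1 - s / len e0 else 0).

Definition slope_after e : R :=
  vdiff pole_vertex_value e / len e - (if e == e0 then s / len e0 else 0).

(** Each branch is written from the end of the edge that it touches, so that the
    values at both ends can be read off. *)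
Definition pole_edge_value e (t : R) : R :=
  if t < breakpoint e then pole_vertex_value (src e) + slope_before e * t
  else pole_vertex_value (tgt e) + slope_after e * (t - len e).

Definition pole_green x : R :=
  match x with
  | Vertex v => pole_vertex_value v
  | Inner e t _ => pole_edge_value e t
  end.

Lemma breakpoint_in e : 0 <= breakpoint e <= len e.
Proof.
by rewrite /breakpoint; case: eqP => [->|_] //; rewrite lexx ltW // len_gt0.
Qed.

Lemma slopes_match e : pole_vertex_value (src e) + slope_before e * breakpoint e =
  pole_vertex_value (tgt e) + slope_after e * (breakpoint e - len e).
Proof.
have le0 := len_gt0 e; have ln : len e != 0 by rewrite gt_eqF.
rewrite /slope_before /slope_after /breakpoint /vdiff; case: eqP => [eE|_].
  by rewrite -eE; field.
by field.
Qed.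

Lemma pole_edge_value_before e t : t <= breakpoint e ->
  pole_edge_value e t = pole_vertex_value (src e) + slope_before e * t.
Proof.
rewrite le_eqVlt => /predU1P[->|tb]; last by rewrite /pole_edge_value tb.
by rewrite /pole_edge_value ltxx slopes_match.
Qed.

Lemma pole_edge_value_after e t : breakpoint e <= t ->
  pole_edge_value e t = pole_vertex_value (tgt e) + slope_after e * (t - len e).
Proof. by rewrite /pole_edge_value ltNge => ->. Qed.

Lemma pole_green_at_edge e t : 0 <= t <= len e ->
  pole_green (at_edge e t) = pole_edge_value e t.
Proof.
move=> /andP[t0 tl]; have /andP[b0 bl] := breakpoint_in e.
move: t0; rewrite le_eqVlt => /predU1P[<-|t0].
  by rewrite at_edge_src pole_edge_value_before // mulr0 addr0.
move: tl; rewrite le_eqVlt => /predU1P[->|tl].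
  by rewrite at_edge_tgt pole_edge_value_after // subrr mulr0 addr0.
have te : 0 < t < len e by rewrite t0.
by rewrite (at_edge_inner te).
Qed.

Lemma pole_edge_lipschitz e (t t' : R) :
  `|pole_edge_value e t - pole_edge_value e t'| <=
  (`|slope_before e| + `|slope_after e|) * `|t - t'|.
Proof.
wlog tt : t t' / t <= t'.
  move=> W; have [|/ltW h] := leP t t'; first exact: W.
  by rewrite distrC [`|t - t'|]distrC; exact: W.
have step1 (a b : R) : a <= b -> b <= breakpoint e ->
    `|pole_edge_value e a - pole_edge_value e b| <= `|slope_before e| * `|a - b|.
  move=> ab bb; rewrite !pole_edge_value_before ?(le_trans ab bb) //.
  by rewrite -normrM mulrBr opprD addrACA subrr add0r.
have step2 (a b : R) : a <= b -> breakpoint e <= a ->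
    `|pole_edge_value e a - pole_edge_value e b| <= `|slope_after e| * `|a - b|.
  move=> ab bb; rewrite !pole_edge_value_after ?(le_trans bb ab) //.
  rewrite -normrM opprD addrACA subrr add0r -mulrBr.
  by rewrite (_ : a - len e - (b - len e) = a - b) //; ring.
have n1 := normr_ge0 (slope_before e); have n2 := normr_ge0 (slope_after e).
have [tb|/ltW bt] := leP t' (breakpoint e).
  by apply: (le_trans (step1 _ _ tt tb)); rewrite ler_wpM2r // lerDl.
have [bt'|/ltW tb] := leP (breakpoint e) t.
  by apply: (le_trans (step2 _ _ tt bt')); rewrite ler_wpM2r // lerDr.
rewrite -(subrKA (pole_edge_value e (breakpoint e))).
apply: (le_trans (ler_normD _ _)).
apply: (le_trans (lerD (step1 _ _ tb (lexx _)) (step2 _ _ bt (lexx _)))).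
rewrite mulrDl; apply: lerD; apply: ler_wpM2l => //.
  by rewrite !ler0_norm ?subr_le0 //; lra.
by rewrite !ler0_norm ?subr_le0 //; lra.
Qed.

Lemma pole_green_continuous : graph_continuous pole_green.
Proof.
pose K : R := \sum_e (`|slope_before e| + `|slope_after e|).
apply: (@graph_continuous_lipschitz _ _ _ K) => // e t t' ht ht'.
rewrite !pole_green_at_edge //; apply: (le_trans (pole_edge_lipschitz _ _ _)).
apply: ler_wpM2r => //; rewrite /K (bigD1 e) //= lerDl.
by apply: sumr_ge0 => i _; rewrite addr_ge0.
Qed.

Definition pole_grad e : R -> R :=
  glue (breakpoint e) (cst (slope_before e)) (cst (slope_after e)).

Lemma pole_weak_derivative e :
  weak_derivative (len e) (restr pole_green e) (pole_grad e).
Proof.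
have bI := breakpoint_in e; have /andP[b0 bl] := bI.
apply: (@weak_derivative_glue _ _ _ _
  (fun t => pole_vertex_value (src e) + slope_before e * t)
  (fun t => (pole_vertex_value (tgt e) - slope_after e * len e) + slope_after e * t)) => //.
- exact: restr_continuous pole_green_continuous.
- move=> t /andP[t0 tb].
  by rewrite /restr pole_green_at_edge ?t0 ?(le_trans tb bl) // pole_edge_value_before.
- move=> t /andP[bt tl].
  rewrite /restr pole_green_at_edge ?tl ?(le_trans b0 bt) // pole_edge_value_after //.
  by ring.
- exact: primitive_on_affine.
- exact: primitive_on_affine.
Qed.

Lemma pole_green_H10 : H10 pole_green.
Proof.
split; last by move=> v ve; rewrite /= /pole_vertex_value !H0 // !mulr0 addr0.
split=> [|e]; first exact: pole_green_continuous.
split; last by exists (pole_grad e); exact: pole_weak_derivative.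
exact: L2_continuous (restr_continuous pole_green_continuous).
Qed.

(** On each edge the integral of the two gradients only involves increments of [phi],
    since the slopes are constant. The interpolated part adds up to the conductance
    form of the vertex values, which the linear system identifies with the
    interpolation of [phi] at the pole; the tent accounts for the difference between
    this interpolation and the value of [phi] at the pole. *)
Lemma pole_green_is_green : is_green (at_edge e0 s) pole_green.
Proof.
split=> [|phi hphi]; first exact: pole_green_H10.
have edge_int e : \int[mu]_(t in `[0, len e]) (grad pole_green e t * grad phi e t) =
    slope_before e * (phi (at_edge e (breakpoint e)) - phi (Vertex (src e))) +
    slope_after e * (phi (Vertex (tgt e)) - phi (at_edge e (breakpoint e))).
  have Lphi := H10_grad_L2 e hphi.
  have bI := breakpoint_in e; have /andP[b0 bl] := bI.
  rewrite (Rintegral_grad pole_green_H10 (pole_weak_derivative e) Lphi).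
  have i := L2_integrable Lphi.
  have i1 : mu.-integrable `[0, breakpoint e] (EFin \o grad phi e).
    exact: integrable_subitv i.
  have i2 : mu.-integrable `[breakpoint e, len e] (EFin \o grad phi e).
    exact: integrable_subitv i.
  have iZ a b c (f : R -> R) : mu.-integrable `[a, b] (EFin \o f) ->
     mu.-integrable `[a, b] (EFin \o (fun t => c * f t)).
    by move=> fi; have := integrableZl (measurable_itvR a b) c fi.
  have [_ E] := Rintegral_glue bI (iZ _ _ (slope_before e) _ i1) (iZ _ _ (slope_after e) _ i2).
  transitivity (\int[mu]_(t in `[0, len e]) glue (breakpoint e)
    (fun t => slope_before e * grad phi e t) (fun t => slope_after e * grad phi e t) t).
    by apply: eq_Rintegral => t _; rewrite /pole_grad /glue; case: ifP.
  rewrite E (RintegralZl _ (measurable_itvR _ _) i1) (RintegralZl _ (measurable_itvR _ _) i2).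
  rewrite !(weak_derivative_increment (@H10_continuous _ _ phi e hphi) (H10_grad e hphi)) //.
  by rewrite /restr at_edge_src at_edge_tgt.
pose phiV v := phi (Vertex v).
have phi0 v : Vend v -> phiV v = 0 by case: hphi => _; apply.
have l0 : len e0 != 0 by rewrite gt_eqF // len_gt0.
rewrite /int_graph (eq_bigr _ (fun e _ => edge_int e)) (bigD1 e0) //=.
rewrite (eq_bigr (fun e => vdiff pole_vertex_value e * vdiff phiV e / len e)); last first.
  move=> e /negPf ne; rewrite /slope_before /slope_after /breakpoint ne addr0 subr0.
  by rewrite at_edge_src /vdiff /phiV; ring.
have form : conductance_form pole_vertex_value phiV =
    (1 - s / len e0) * phiV (src e0) + s / len e0 * phiV (tgt e0).
  rewrite -(HE (src e0) phi0) -(HE (tgt e0) phi0) /conductance_form !mulr_sumr -big_split.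
  by apply: eq_bigr => e _; rewrite /= /vdiff /pole_vertex_value; ring.
rewrite /conductance_form (bigD1 e0) //= in form.
set S := \sum_(e | e != e0) _ in form *.
have -> : S = (1 - s / len e0) * phiV (src e0) + s / len e0 * phiV (tgt e0) -
  vdiff pole_vertex_value e0 * vdiff phiV e0 / len e0 by rewrite -form; ring.
rewrite /slope_before /slope_after /breakpoint eqxx -/(phiV (src e0)) -/(phiV (tgt e0)).
by rewrite [vdiff phiV _]/vdiff; field.
Qed.

End ExplicitGreen.

(** * The diagonal of the Green function *)
Section GreenDiagonal.
Context {R : realType} {G : metric_graph R}.
Implicit Types (e : edge G) (x y : gpoint G) (phi g : gpoint G -> R).
Context (Gc : connected_graph G) (Ge : exists v : vertex G, Vend v).

Lemma is_green_exists y : exists g, is_green y g.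
Proof.
have [H [H0 HE]] := discrete_green Gc Ge.
have [e [s [hs ->]]] := gpoint_at_edge Gc Ge y.
by exists (pole_green H e s); exact: pole_green_is_green.
Qed.

(** Both sides are the Dirichlet product of the two functions. *)
Lemma is_green_sym x y gx gy : is_green x gx -> is_green y gy -> gy x = gx y.
Proof.
move=> [hx Ex] [hy Ey]; rewrite -(Ex _ hy) -(Ey _ hx); exact: dirichletC.
Qed.

(** By symmetry every Green function with pole [y] takes at [x] the value that a Green
    function with pole [x] takes at [y], so there is only one. If [y] is an end
    vertex that value is 0, as the definition of [green] prescribes. *)
Lemma greenE y g x : is_green y g -> green x y = g x.
Proof.
move=> gy; have [gx hx] := is_green_exists x; rewrite (is_green_sym hx gy) /green.
case: ifPn => [|_].
  case: y gy => //= v _ ve; have [[_ z] _] := hx; by rewrite z.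
exact: (is_green_sym hx (xgetI (cst 0) gy)).
Qed.

Lemma green_diagonal_bound y phi : H10 phi ->
  phi y ^+ 2 <= green y y * dirichlet phi phi.
Proof.
by move=> hphi; have [g hg] := is_green_exists y; rewrite (greenE _ hg); exact: green_cauchy_schwarz.
Qed.

(** Along an edge the vertex values are affine in the position of the pole and so are
    the slopes, so the diagonal is a quadratic polynomial. *)
Lemma green_diagonal_continuous e :
  {within `[0, len e], continuous (fun s => green (at_edge e s) (at_edge e s))}.
Proof.
have [H [H0 HE]] := discrete_green Gc Ge.
pose h v (s : R) := (1 - s / len e) * H (src e) v + s / len e * H (tgt e) v.
pose q s := h (tgt e) s + ((h (tgt e) s - h (src e) s) / len e - s / len e) * (s - len e).
have cq : continuous q.
  have cl : continuous (fun s : R => s / len e).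
    by move=> s; apply: cvgM; [exact: cvg_id|exact: cvg_cst].
  have ch v : continuous (h v).
    move=> s; apply: cvgD; apply: cvgM; try exact: cvg_cst; last exact: cl.
    by apply: cvgB; [exact: cvg_cst|exact: cl].
  move=> s; apply: cvgD; first exact: ch.
  apply: cvgM; last by apply: cvgB; [exact: cvg_id|exact: cvg_cst].
  apply: cvgB; last exact: cl.
  by apply: cvgM; [apply: cvgB; exact: ch|exact: cvg_cst].
have qE s : 0 <= s <= len e -> green (at_edge e s) (at_edge e s) = q s.
  move=> sl; rewrite (greenE _ (pole_green_is_green Gc Ge H0 HE sl)).
  rewrite pole_green_at_edge // pole_edge_value_after ?/breakpoint ?eqxx //.
  by rewrite /slope_after eqxx.
apply/within_continuous_itvP => t tl eps eps0.
have [d d0 dP] := (within_continuous_itvP _ _ _).1 (continuous_subspaceT cq) t tl eps eps0.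
by exists d => // s sl ts; rewrite !qE //; exact: dP.
Qed.

Lemma green_argmax_nonempty : exists a, green_argmax G a.
Proof.
have [v _] := Ge; have [e0 _] := incident_exists Gc Ge v.
have /choice[c cP] : forall e, exists c, 0 <= c <= len e /\
    forall t, 0 <= t <= len e ->
      green (at_edge e t) (at_edge e t) <= green (at_edge e c) (at_edge e c).
  move=> e; have [c cI cP] := EVT_max (ltW (len_gt0 e)) (@green_diagonal_continuous e).
  by exists c; split=> [|t tl]; [move: cI|have := cP t]; rewrite in_itv //=; apply.
pose F e := green (at_edge e (c e)) (at_edge e (c e)).
have [e _ eP] := @Order.TotalTheory.arg_maxP _ _ _ e0 xpredT F isT.
exists (at_edge e (c e)) => x; have [e' [t [tl ->]]] := gpoint_at_edge Gc Ge x.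
by apply: le_trans (eP e' isT); have [_] := cP e'; apply.
Qed.

(** Compactness, edge by edge: remove from the edge the open eps-neighbourhoods of
    the maximum points that it carries. On the compact rest the diagonal attains its
    maximum, which is smaller than the global one. *)
Lemma green_far_from_argmax a (eps : R) : green_argmax G a -> 0 < eps ->
  exists2 delta : R, 0 < delta &
  forall x, (forall b, green_argmax G b -> eps <= dist x b) ->
    green x x <= green a a - delta.
Proof.
move=> aM eps0.
have /choice[d dP] : forall e, exists d : R, 0 < d /\
    forall t, 0 <= t <= len e ->
      (forall b, green_argmax G b -> eps <= dist (at_edge e t) b) ->
      green (at_edge e t) (at_edge e t) <= green a a - d.
  move=> e; pose M' := [set s : R | 0 <= s <= len e /\ green_argmax G (at_edge e s)].
  (* Distances within the edge only: they dominate the graph distance, and the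
     set so defined is closed by inspection. *)
  pose K := `[0, len e]%classic `&` \bigcap_(s in M') [set t : R | eps <= `|t - s|].
  have farK t : 0 <= t <= len e ->
      (forall b, green_argmax G b -> eps <= dist (at_edge e t) b) -> K t.
    move=> tl far; split; first by rewrite /= in_itv.
    move=> s [sl sM] /=; apply: (le_trans (far _ sM)).
    by rewrite distrC; exact: dist_edge.
  have cK : compact K.
    apply: (subclosed_compact _ (@segment_compact R 0 (len e))); last by move=> t [].
    apply: closedI; first exact: interval_closed.
    apply: closed_bigI => s _.
    have cs : continuous (fun t : R => `|t - s|).
      by move=> t; apply: cvg_norm; apply: cvgB; [exact: cvg_id|exact: cvg_cst].
    exact: (@preimage_closed _ _ (fun t : R => `|t - s|) [set r | eps <= r]
      (fun t _ => cs t) (@closed_ge R eps)).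
  have [K0|/set0P K0] := eqVneq K set0.
    exists 1; split=> // t tl far; have := farK t tl far; by rewrite K0.
  have cg : {within K, continuous (fun s => green (at_edge e s) (at_edge e s))}.
    by apply: continuous_subspaceW (@green_diagonal_continuous e) => t [].
  have [c cK' cP] := compact_EVT_max K0 cK cg.
  move: cK'; rewrite inE => -[]; rewrite /= in_itv /= => cl cfar.
  have cM : ~ green_argmax G (at_edge e c).
    move=> cM; have := cfar c (conj cl cM); rewrite /= subrr normr0 leNgt eps0 //.
  exists (green a a - green (at_edge e c) (at_edge e c)); split.
    rewrite subr_gt0 ltNge; apply/negP => h; apply: cM => x.
    by apply: le_trans h; exact: aM.
  by move=> t tl /(farK t tl) tK; rewrite subKr; apply: cP; rewrite inE.
exists (\big[Order.min/1]_e d e).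
  by apply: lt_bigmin => // e _; have [] := dP e.
move=> x far; have [e [t [tl xE]]] := gpoint_at_edge Gc Ge x; rewrite xE in far *.
have [_ dE] := dP e; apply: (le_trans (dE t tl far)).
by rewrite lerD2l lerN2; exact: bigmin_le_cond.
Qed.

End GreenDiagonal.

(** * Solutions on the graph *)
Section Endpoints.
Context {R : realType}.
Implicit Types (a b l t : R) (f w : R -> R).

Lemma primitive_on_mean_value a b f w x y : primitive_on a b f w ->
  a <= x -> x < y -> y <= b -> exists2 c, x < c < y & f y - f x = w c * (y - x).
Proof.
move=> p ax xy yb; have [cf _ d] := primitive_on_subitv ax yb p.
have dI c : c \in `]x, y[ -> is_derive c 1 f (w c) by rewrite in_itv /=; exact: d.
have [c cI E] := MVT xy dI cf.
by exists c => //; move: cI; rewrite in_itv.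
Qed.

Lemma primitive_on_right_derivative l f w : 0 < l -> primitive_on 0 l f w ->
  (f t - f 0) / t @[t --> 0^'+] --> w 0.
Proof.
move=> l0 p; apply/cvgrPdist_lt => eps eps0; have [_ cw _] := p.
have z : 0 <= (0 : R) <= l by rewrite lexx ltW.
have [d d0 dP] := (within_continuous_itvP _ _ _).1 cw 0 z eps eps0.
near=> t.
have t0 : 0 < t by near: t; exact: nbhs_right_gt.
have tl : t <= l by near: t; exact: nbhs_right_le.
have td : t < d by near: t; exact: nbhs_right_lt.
have [c /andP[c0 ct] ->] := primitive_on_mean_value p (lexx 0) t0 tl.
rewrite subr0 mulfK ?gt_eqF //; apply: dP; first by rewrite ltW //= (le_trans (ltW ct)).
by rewrite sub0r normrN gtr0_norm // (lt_trans ct).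
Unshelve. all: by end_near.
Qed.

Lemma primitive_on_left_derivative l f w : 0 < l -> primitive_on 0 l f w ->
  (f (l - t) - f l) / t @[t --> 0^'+] --> - w l.
Proof.
move=> l0 p; apply/cvgrPdist_lt => eps eps0; have [_ cw _] := p.
have z : 0 <= l <= l by rewrite lexx ltW.
have [d d0 dP] := (within_continuous_itvP _ _ _).1 cw l z eps eps0.
near=> t.
have t0 : 0 < t by near: t; exact: nbhs_right_gt.
have tl : t <= l by near: t; exact: nbhs_right_le.
have td : t < d by near: t; exact: nbhs_right_lt.
have h1 : 0 <= l - t by rewrite subr_ge0.
have h2 : l - t < l by rewrite ltrBlDr ltrDl.
have [c /andP[c0 cl] E] := primitive_on_mean_value p h1 h2 (lexx l).
have -> : f (l - t) - f l = - w c * t.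
  by rewrite -opprB E; ring.
rewrite mulfK ?gt_eqF // -opprD normrN; apply: dP; first by clear - c0 cl h1; lra.
by rewrite ltr_norml; clear - c0 cl td t0; lra.
Unshelve. all: by end_near.
Qed.

End Endpoints.

Section SolutionsOnGraph.
Context {R : realType} {G : metric_graph R}.
Notation mu := (@lebesgue_measure R).
Implicit Types (e : edge G) (v : vertex G) (u : gpoint G -> R) (p : R).

Lemma restr_src u e : restr u e 0 = u (Vertex (src e)).
Proof. by rewrite /restr at_edge_src. Qed.

Lemma restr_tgt u e : restr u e (len e) = u (Vertex (tgt e)).
Proof. by rewrite /restr at_edge_tgt. Qed.

Lemma solution_ge0 p u : lane_emden p u -> forall e t, 0 <= t <= len e -> 0 <= restr u e t.
Proof.
move=> [cu sol _ _] e; apply: (@nonneg_on_closed_itv R (len e) (restr u e) (len_gt0 e)).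
  exact: restr_continuous.
by move=> t te; have [_ _ _] := sol e t te.
Qed.

Lemma solution_primitive p u e : 1 < p -> lane_emden p u ->
  exists w, primitive_on 0 (len e) (restr u e) w /\
            primitive_on 0 (len e) w (fun t => - restr u e t `^ p).
Proof.
move=> p1 [cu sol _ _]; apply: primitive_on_solution; rewrite ?len_gt0 ?(ltW p1) //.
  exact: restr_continuous.
by move=> t te; exact: sol.
Qed.

(** The derivative stays bounded up to the ends of the edges, end vertices included
    [primitive_on_solution], so the classical derivative is a weak one. *)
Lemma solution_H10 p u : 1 < p -> lane_emden p u -> H10 u.
Proof.
move=> p1 le; have [cu _ _ u0] := le; split=> //; split=> // e.
have [w [pw _]] := solution_primitive e p1 le.
split; first exact: L2_continuous (restr_continuous cu).
by exists w; apply: primitive_on_weak_derivative => //; exact: ltW (len_gt0 e).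
Qed.

(** Multiply the equation by the solution and integrate by parts. The boundary terms,
    sorted by vertices, vanish: by the Kirchhoff condition at interior vertices and
    because the solution vanishes at end vertices. *)
Lemma solution_energy_identity p u : (forall v : vertex G, degree v != 2%N) ->
  1 < p -> lane_emden p u ->
  dirichlet u u = int_graph (fun e t => `|restr u e t| `^ (p + 1)).
Proof.
move=> Gdeg p1 le; have pp : 0 < p + 1 by lra.
have hu := solution_H10 p1 le.
have [cu sol kir uend] := le.
have /choice[W WP] : forall e, exists w, primitive_on 0 (len e) (restr u e) w /\
            primitive_on 0 (len e) w (fun t => - restr u e t `^ p).
  by move=> e; exact: solution_primitive.
have edgeE e : \int[mu]_(t in `[0, len e]) (grad u e t * grad u e t) =
    u (Vertex (tgt e)) * W e (len e) - u (Vertex (src e)) * W e 0 +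
    \int[mu]_(t in `[0, len e]) (`|restr u e t| `^ (p + 1)).
  have [p1' p2] := WP e; have l0 := ltW (len_gt0 e).
  have wd := primitive_on_weak_derivative l0 p1'.
  have [LW _] := wd.
  rewrite (Rintegral_grad hu wd (H10_grad_L2 e hu)).
  under eq_Rintegral do rewrite mulrC.
  rewrite (Rintegral_grad hu wd LW).
  have := Rintegral_by_parts_on l0 p1' p2.
  rewrite restr_src restr_tgt => E.
  have <- : \int[mu]_(t in `[0, len e]) (- 1 * (restr u e t * - restr u e t `^ p)) =
            \int[mu]_(t in `[0, len e]) (`|restr u e t| `^ (p + 1)).
    apply: eq_Rintegral => t; rewrite inE /= in_itv /= => tl.
    have u0 := solution_ge0 le tl.
    rewrite ger0_norm // powRD ?(gt_eqF pp) //.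
    by rewrite powRr1 //; ring.
  have [cf _ _] := p1'; have [_ ck _] := p2.
  rewrite (RintegralZl _ (measurable_itvR 0 (len e))
    (integrable_itv_continuous (within_continuousM cf ck))) E.
  by ring.
rewrite /dirichlet /int_graph (eq_bigr _ (fun e _ => edgeE e)) big_split /=.
rewrite -[RHS]add0r; congr (_ + _).
(* the outward derivative at v along e *)
pose D v e := if src e == v then W e 0 else - W e (len e).
have vertexE v : u (Vertex v) * \sum_(e | incident e v) D v e = 0.
  have [ve|ve] := boolP (Vend v); first by rewrite uend // mul0r.
  have [vi|vi] := boolP (Vint v); last first.
    rewrite big_pred0 ?mulr0 // => e; apply/negbTE/negP => ev.
    have d0 : (0 < degree v)%N by rewrite /degree card_gt0; apply/set0Pn; exists e; rewrite inE.
    have := Gdeg v; move: ve vi d0; rewrite /Vend /Vint.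
    by case: (degree v) => [|[|[|?]]].
  have [d [dP d0]] := kir v vi; rewrite (eq_bigr d) ?d0 ?mulr0 // => e ev.
  have l0 := len_gt0 e; have [p1' _] := WP e; have := dP e ev.
  have lims (a b : R) (F : R -> R) : F t @[t --> 0^'+] --> a -> F t @[t --> 0^'+] --> b -> a = b.
    by move=> Fa Fb; apply: (@cvg_unique _ (@norm_hausdorff _ R^o) _ _ _ _ Fa Fb).
  rewrite /is_outward_deriv /at_edge_from /D; case: eqP => [sv|sv] lim_d.
    have := primitive_on_right_derivative l0 p1'.
    rewrite restr_src sv => lim_w; exact: lims lim_w lim_d.
  have tv : tgt e = v by move: ev; rewrite /incident => /orP[/eqP//|/eqP].
  have := primitive_on_left_derivative l0 p1'.
  rewrite restr_tgt tv => lim_w; exact: lims lim_w lim_d.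
have -> : \sum_e (u (Vertex (tgt e)) * W e (len e) - u (Vertex (src e)) * W e 0) =
  - \sum_v u (Vertex v) * \sum_(e | incident e v) D v e.
  under [in RHS]eq_bigr do rewrite mulr_sumr.
  rewrite (exchange_big_dep xpredT) //= -sumrN; apply: eq_bigr => e _.
  have st := no_loop e; have ts : tgt e != src e by rewrite eq_sym.
  rewrite (bigD1 (src e)) /=; last by rewrite /incident eqxx.
  rewrite (bigD1 (tgt e)) /=; last by rewrite /incident eqxx orbT.
  rewrite big1 ?addr0 /D ?eqxx ?(negPf st); first by ring.
  by move=> v /andP[/andP[]]; rewrite /incident => /orP[/eqP->|/eqP->]; rewrite eqxx.
by rewrite big1 ?oppr0.
Qed.

End SolutionsOnGraph.

(** * Comparison of the least energy with a test function *)
Section LeastEnergy.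
Context {R : realType} {G : metric_graph R}.
Notation mu := (@lebesgue_measure R).
Implicit Types (e : edge G) (v : vertex G) (u phi : gpoint G -> R) (p : R).

Definition power_integral p u := int_graph (fun e t => `|restr u e t| `^ (p + 1)).

Lemma energyE p u : energy p u = 2^-1 * dirichlet u u - (p + 1)^-1 * power_integral p u.
Proof.
rewrite /energy /dirichlet; congr (_ * _ - _); apply: eq_bigr => e _.
by apply: eq_Rintegral => t _; rewrite real_normK ?num_real // expr2.
Qed.

Lemma H10Z (c : R) phi : H10 phi -> H10 (fun x => c * phi x).
Proof.
move=> hphi; have [[cphi hedge] phi0] := hphi.
split; last by move=> v /phi0 ->; rewrite mulr0.
split=> [x eps eps0|e].
  have c1 : 0 < `|c| + 1 by rewrite ltr_wpDl.
  have [d d0 dP] := cphi x (eps / (`|c| + 1)) (divr_gt0 eps0 c1).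
  exists d => // y /dP; rewrite ltr_pdivlMr // => h.
  rewrite -mulrBr normrM mulrC; apply: le_lt_trans h.
  by rewrite ler_wpM2l // lerDl.
have [Lf [g wg]] := hedge e; split; first exact: (L2Z c Lf).
by exists (fun t => c * g t); exact: weak_derivativeZ.
Qed.

Lemma dirichletZ (c : R) phi : H10 phi ->
  dirichlet (fun x => c * phi x) (fun x => c * phi x) = c ^+ 2 * dirichlet phi phi.
Proof.
move=> hphi; rewrite /dirichlet /int_graph mulr_sumr; apply: eq_bigr => e _.
have hc := H10Z c hphi; have L1 := H10_grad_L2 e hphi.
have wc : weak_derivative (len e) (restr (fun x => c * phi x) e) (fun t => c * grad phi e t).
  by apply: weak_derivativeZ; [have [[_ /(_ e)[]]] := hphi|exact: H10_grad].
rewrite (Rintegral_grad hc wc (H10_grad_L2 e hc)).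
under eq_Rintegral do rewrite mulrC.
rewrite (Rintegral_grad hc wc (L2Z c L1)).
rewrite -(RintegralZl (c ^+ 2) (measurable_itvR 0 (len e)) (L2_integrableM L1 L1)).
by apply: eq_Rintegral => t _; ring.
Qed.

Lemma power_continuous p u e : 0 <= p -> graph_continuous u ->
  {within `[0, len e], continuous (fun t => `|restr u e t| `^ (p + 1))}.
Proof.
move=> p0 cu; apply: within_continuous_powR; first by rewrite lerDr.
  have /subspace_continuousP c := @restr_continuous _ _ u e cu.
  by apply/subspace_continuousP => t /c; exact: cvg_norm.
by move=> t _.
Qed.

Lemma power_integralZ p (c : R) u : 0 <= p -> 0 < c -> graph_continuous u ->
  power_integral p (fun x => c * u x) = c `^ (p + 1) * power_integral p u.
Proof.
move=> p0 c0 cu; rewrite /power_integral /int_graph mulr_sumr; apply: eq_bigr => e _.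
have cp := @power_continuous p u e p0 cu.
rewrite -(RintegralZl _ (measurable_itvR 0 (len e)) (integrable_itv_continuous cp)).
by apply: eq_Rintegral => t _; rewrite -powRM ?(ltW c0) // -{2}(gtr0_norm c0) -normrM.
Qed.

Lemma power_integral_ge0 p u : 0 <= power_integral p u.
Proof. by apply: sumr_ge0 => e _; apply: Rintegral_ge0 => t _; exact: powR_ge0. Qed.

(** Bound t^(p+1), a convex function of t^2, from below by its tangent at t^2 = s. With
    equality in the last hypothesis the right-hand side is the exact maximum over t,
    attained at t^2 = s; the inequality leaves room for a convenient [s]. *)
Lemma ray_energy_bound p (a b s t : R) : 1 < p -> 0 <= a -> 0 <= b -> 0 < s -> 0 < t ->
  a <= b * s `^ ((p - 1) / 2) ->
  2^-1 * (t ^+ 2 * a) - (p + 1)^-1 * (t `^ (p + 1) * b) <=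
  (2^-1 - (p + 1)^-1) * (a * s).
Proof.
move=> p1 a0 b0 s0 t0 ab.
pose q := (p + 1) / 2.
have q1 : 1 <= q by rewrite /q; lra.
have tE : t `^ (p + 1) = (t ^+ 2) `^ q.
  by rewrite -powR_mulrn ?(ltW t0) // -powRrM /q; congr (_ `^ _); field.
have := powR_tangent q1 s0 (sqr_ge0 t).
have sE := powR_predM q s0.
have qE : q - 1 = (p - 1) / 2 by rewrite /q; field.
rewrite -sE tE qE.
have pE : p + 1 = 2 * q by rewrite /q; field.
rewrite pE => tan; have T0 := powR_ge0 (t ^+ 2) q; have r0 := sqr_ge0 t.
move: ab T0 r0 tan; move: ((t ^+ 2) `^ q) => T; move: (t ^+ 2) (s `^ ((p - 1) / 2)) => r S ab T0 r0 tan.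
have key : a * (s + q * (r - s)) <= b * T.
  have [neg|pos] := leP (s + q * (r - s)) 0.
    by apply: (@le_trans _ _ 0); [rewrite mulr_ge0_le0|rewrite mulr_ge0].
  apply: (@le_trans _ _ (b * S * (s + q * (r - s)))); first by rewrite ler_wpM2r // ltW.
  rewrite -mulrA ler_wpM2l //; apply: le_trans tan; rewrite le_eqVlt; apply/orP; left.
  by apply/eqP; ring.
have q0 : 0 < q by lra.
have : (2 * q)^-1 * (a * (s + q * (r - s))) <= (2 * q)^-1 * (T * b).
  by rewrite [T * b]mulrC ler_wpM2l // invr_ge0; lra.
have -> : (2 * q)^-1 * (a * (s + q * (r - s))) =
  2^-1 * (r * a) - (2^-1 - (2 * q)^-1) * (a * s) by field; rewrite gt_eqF.
by lra.
Qed.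

(** The energies of the multiples of [phi] bound the least energy from above; the
    factor 1/2 - 1/(p+1) is common to both sides. *)
Lemma least_energy_solution_bound p u phi (s : R) :
  (forall v : vertex G, degree v != 2%N) -> 1 < p ->
  least_energy_solution p u -> H10 phi -> phi <> cst 0 -> 0 < s ->
  dirichlet phi phi <= power_integral p phi * s `^ ((p - 1) / 2) ->
  dirichlet u u <= dirichlet phi phi * s.
Proof.
move=> Gdeg p1 [le uE] hphi phi0 s0 cond.
have EU : energy p u = (2^-1 - (p + 1)^-1) * dirichlet u u.
  by rewrite energyE /power_integral -(solution_energy_identity Gdeg p1 le); ring.
have c0 : 0 < 2^-1 - (p + 1)^-1.
  by rewrite subr_gt0 ltf_pV2 ?posrE; clear - p1; lra.
have : ((energy p u)%:E <= ((2^-1 - (p + 1)^-1) * (dirichlet phi phi * s))%:E)%E.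
  rewrite uE; apply: (le_trans (y := ereal_sup
      [set (energy p (fun x => t * phi x))%:E | t in [set t | 0 < t]])).
    by apply: ereal_inf_lbound; exists phi.
  apply: ge_ereal_sup => _ [t /= t0 <-]; rewrite lee_fin energyE dirichletZ //.
  have [[cphi _] _] := hphi; have p0 : 0 <= p by clear - p1; lra.
  rewrite power_integralZ //; apply: ray_energy_bound => //.
    exact: dirichlet_ge0.
  exact: power_integral_ge0.
by rewrite lee_fin EU ler_pM2l.
Qed.

End LeastEnergy.

(** * Concentration as the exponent tends to infinity *)
Section Concentration.
Context {R : realType} {G : metric_graph R}.
Notation mu := (@lebesgue_measure R).
Implicit Types (e : edge G) (v : vertex G) (u phi : gpoint G -> R) (p : R).

(** [c] is the length of an interval containing [s] on which |u| >= r. What matters is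
    that it does not depend on [p]. *)
Lemma power_integral_lower u e (s r : R) : graph_continuous u -> 0 <= s <= len e ->
  0 <= r -> r < `|u (at_edge e s)| ->
  exists2 c : R, 0 < c & forall p, 0 <= p -> c * r `^ (p + 1) <= power_integral p u.
Proof.
move=> cu sl r0 rs; have cf := @restr_continuous _ _ u e cu.
have eps0 : 0 < `|restr u e s| - r by rewrite subr_gt0.
have [d d0 dP] := (within_continuous_itvP _ _ _).1 cf s sl _ eps0.
have l0 := len_gt0 e.
have [a [b [a0 ab bl near_s]]] : exists a b : R, [/\ 0 <= a, a < b, b <= len e &
    forall t, a <= t <= b -> `|s - t| < d].
  have [m1 m2] : Num.min d (len e) <= d /\ Num.min d (len e) <= len e.
    by rewrite !ge_min !lexx orbT.
  have m0 : 0 < Num.min d (len e) by rewrite lt_min d0.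
  move: m1 m2 m0; move: (Num.min d (len e)) => m m1 m2 m0.
  have [h|h] := leP s (len e / 2).
    exists s, (s + m / 2); clear - sl h m0 m1 m2 d0; split; [lra..|].
    by move=> t ?; rewrite ltr_norml; lra.
  exists (s - m / 2), s; clear - sl h m0 m1 m2 d0; split; [lra..|].
  by move=> t ?; rewrite ltr_norml; lra.
exists (b - a) => [|p p0]; first by rewrite subr_gt0.
pose k t := `|restr u e t| `^ (p + 1).
have ck : {within `[0, len e], continuous k} by exact: power_continuous.
have ik := integrable_itv_continuous ck.
have k0 t : 0 <= k t by exact: powR_ge0.
have al : 0 <= a <= len e by clear - a0 ab bl; lra.
have abl : a <= b <= len e by clear - a0 ab bl; lra.
have iab : mu.-integrable `[a, b] (EFin \o k) by exact: integrable_subitv ik.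
have lower : (b - a) * r `^ (p + 1) <= \int[mu]_(t in `[a, b]) k t.
  have pr := primitive_on_affine a b 0 (r `^ (p + 1)).
  have [_ cc _] := pr; have := Rintegral_primitive_on (ltW ab) pr.
  have -> : 0 + r `^ (p + 1) * b - (0 + r `^ (p + 1) * a) = (b - a) * r `^ (p + 1) by ring.
  move=> <-; apply: le_Rintegral => //; first exact: integrable_itv_continuous cc.
  move=> t; rewrite /= in_itv /= => tab; rewrite /k ge0_ler_powR ?nnegrE //.
    by rewrite addr_ge0.
  have tl : 0 <= t <= len e by move: tab => /andP[h1 h2]; rewrite (le_trans a0 h1) (le_trans h2 bl).
  have := dP t tl (near_s t tab).
  have := lerB_dist (restr u e s) (restr u e t).
  move: (restr u e s) (restr u e t) => y z; clear; lra.
apply: (le_trans lower).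
have step1 : \int[mu]_(t in `[a, b]) k t <= \int[mu]_(t in `[0, len e]) k t.
  rewrite (Rintegral_itv_cat al ik) (Rintegral_itv_cat abl); last exact: integrable_subitv ik.
  have h1 : 0 <= \int[mu]_(t in `[0, a]) k t by exact: Rintegral_ge0.
  have h2 : 0 <= \int[mu]_(t in `[b, len e]) k t by exact: Rintegral_ge0.
  by rewrite addrCA lerDl addr_ge0.
apply: (le_trans step1); rewrite /power_integral /int_graph (bigD1 e) //= lerDl.
by apply: sumr_ge0 => i _; apply: Rintegral_ge0 => t _; exact: powR_ge0.
Qed.

Lemma power_integral_upper u (m : R) p : graph_continuous u -> 0 <= p ->
  (forall y, `|u y| <= m) ->
  power_integral p u <= (\sum_(e : edge G) len e) * m `^ (p + 1).
Proof.
move=> cu p0 um; rewrite /power_integral /int_graph mulr_suml; apply: ler_sum => e _.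
have pr := primitive_on_affine 0 (len e) 0 (m `^ (p + 1)).
have [_ cc _] := pr; have := Rintegral_primitive_on (ltW (len_gt0 e)) pr.
have -> : 0 + m `^ (p + 1) * len e - (0 + m `^ (p + 1) * 0) = len e * m `^ (p + 1) by ring.
move=> <-; apply: le_Rintegral => //.
- by apply: integrable_itv_continuous; exact: power_continuous.
- exact: integrable_itv_continuous cc.
- move=> t _; have h := um (at_edge e t); rewrite ge0_ler_powR ?nnegrE ?addr_ge0 //.
  exact: le_trans (normr_ge0 _) h.
Qed.

Context (Gc : connected_graph G) (Gdeg : forall v : vertex G, degree v != 2%N)
  (Ge : exists v : vertex G, Vend v).
Context (u : R -> gpoint G -> R) (x : R -> gpoint G)
  (hu : forall p : R, 1 < p -> least_energy_solution p (u p))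
  (hx : forall p : R, 1 < p -> maximum_point (u p) (x p)).

Lemma solution_nonneg p : 1 < p -> forall y, 0 <= u p y.
Proof.
move=> p1 y; have [e [t [tl ->]]] := gpoint_at_edge Gc Ge y.
by have [le _] := hu p1; exact: (solution_ge0 le).
Qed.

Lemma maximum_gt0 p : 1 < p -> 0 < u p (x p).
Proof.
move=> p1; have [v _] := Ge; have [e _] := incident_exists Gc Ge v.
have [[_ sol _ _] _] := hu p1; have l0 := len_gt0 e.
have [|_ _ _ pos] := sol e (len e / 2); first by lra.
by apply: (lt_le_trans pos); exact: hx.
Qed.

Lemma maximum_sqr_bound p : 1 < p ->
  u p (x p) ^+ 2 <= green (x p) (x p) * dirichlet (u p) (u p).
Proof.
move=> p1; apply: green_diagonal_bound => //.
by have [le _] := hu p1; exact: solution_H10 le.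
Qed.

Context (a : gpoint G) (aM : green_argmax G a).

Lemma solution_dirichlet_gt0 p : 1 < p -> 0 < dirichlet (u p) (u p).
Proof.
move=> p1; rewrite lt_neqAle dirichlet_ge0 andbT; apply/eqP => D0.
have := maximum_sqr_bound p1; rewrite -D0 mulr0 leNgt exprn_gt0 //.
exact: maximum_gt0.
Qed.

(** Otherwise the bound by the diagonal would force every function of H^1_0 to vanish,
    in contrast to the solution for p = 2. *)
Lemma green_argmax_gt0 : 0 < green a a.
Proof.
have p1 : 1 < (2 : R) by rewrite ltr1n.
have D0 := solution_dirichlet_gt0 p1; have U0 := maximum_gt0 p1.
have := maximum_sqr_bound p1; have := aM (x 2).
rewrite ltNge => m1 m2; apply/negP => m0.
have : u 2 (x 2) ^+ 2 <= 0.
  by apply: (le_trans m2); rewrite mulr_le0_ge0 ?(le_trans m1) // ltW.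
by rewrite leNgt exprn_gt0.
Qed.

(** With L the total length and U the maximum, the energy identity gives
    D(u) <= L U^(p-1) U^2 <= L U^(p-1) G(a, a) D(u). Hence 1 <= L G(a, a) U^(p-1),
    which fails for large p if U^2 stays below a number smaller than 1. *)
Lemma maximum_liminf (eps : R) : 0 < eps < 1 ->
  exists P : R, forall p, P < p -> 1 - eps < u p (x p) ^+ 2.
Proof.
move=> /andP[eps0 eps1]; pose L := \sum_(e : edge G) len e.
have b1 : 1 < (1 - eps)^-1 by rewrite invf_gt1 ?subr_gt0 // gtrBl.
have [P PP] := powR_large (L * green a a) b1.
exists (Num.max 1 (2 * P + 1)) => p; rewrite gt_max => /andP[p1 pP].
have [p0 q0 pq] : [/\ 0 <= p, 0 <= (p - 1) / 2 & P < (p - 1) / 2] by split; lra.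
have [le _] := hu p1; have [cu _ _ _] := le; have U0 := maximum_gt0 p1.
rewrite ltNge; apply/negP => small.
have D0 := solution_dirichlet_gt0 p1.
have DL : dirichlet (u p) (u p) <= L * u p (x p) `^ (p + 1).
  rewrite (solution_energy_identity Gdeg p1 le).
  apply: power_integral_upper => // y.
  by rewrite ger0_norm ?solution_nonneg //; exact: hx.
have L0 : 0 <= L by apply: sumr_ge0 => e _; rewrite ltW // len_gt0.
have split_pow : u p (x p) `^ (p + 1) = u p (x p) `^ (p - 1) * u p (x p) ^+ 2.
  rewrite -powR_mulrn ?(ltW U0) // -powRD; last by rewrite (gt_eqF U0) implybT.
  by congr (_ `^ _); ring.
have sqr_pow : u p (x p) `^ (p - 1) = (u p (x p) ^+ 2) `^ ((p - 1) / 2).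
  by rewrite -powR_mulrn ?(ltW U0) // -powRrM; congr (_ `^ _); field.
have U2 : u p (x p) ^+ 2 <= green a a * dirichlet (u p) (u p).
  by apply: (le_trans (maximum_sqr_bound p1)); rewrite ler_wpM2r ?(ltW D0).
have pow_small : u p (x p) `^ (p - 1) <= (1 - eps) `^ ((p - 1) / 2).
  by rewrite sqr_pow ge0_ler_powR ?nnegrE ?sqr_ge0 // subr_ge0 ltW.
have lower : 1 <= L * green a a * (1 - eps) `^ ((p - 1) / 2).
  rewrite -(ler_pM2r D0) mul1r; apply: (le_trans DL); rewrite split_pow.
  rewrite -!mulrA ler_wpM2l // [leRHS]mulrCA.
  by rewrite ler_pM ?powR_ge0 ?sqr_ge0.
have PPp : L * green a a < (1 - eps)^-1 `^ ((p - 1) / 2) by exact: PP.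
have e1 : 0 < 1 - eps by rewrite subr_gt0.
have pow0 : 0 < (1 - eps) `^ ((p - 1) / 2) by exact: powR_gt0.
move: lower; rewrite leNgt => /negP; apply.
have one : 1 = (1 - eps)^-1 `^ ((p - 1) / 2) * (1 - eps) `^ ((p - 1) / 2).
  by rewrite -powRM ?invr_ge0 ?(ltW e1) // mulVf ?gt_eqF // powR1.
by rewrite [ltRHS]one ltr_pM2r.
Qed.

(** Compare with the multiples of g = G(., a), for which D(g) = g(a) = m. *)
Lemma dirichlet_limsup (eps : R) : 0 < eps < 1 ->
  exists P : R, forall p, P < p ->
    dirichlet (u p) (u p) <= (green a a * (1 - eps) ^+ 3)^-1.
Proof.
move=> /andP[eps0 eps1]; have m0 := green_argmax_gt0.
have [g hg] := is_green_exists Gc Ge a; have gaE := greenE Gc Ge a hg.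
have [hg0 gE] := hg; have [[cg _] _] := hg0.
have Dg : dirichlet g g = green a a by rewrite gaE; exact: gE.
have e1 : 0 < 1 - eps by rewrite subr_gt0.
pose m := green a a; pose r := m * (1 - eps).
have r0 : 0 < r by rewrite mulr_gt0.
have [e [t [tl aE]]] := gpoint_at_edge Gc Ge a.
have [c c0 cP] : exists2 c : R, 0 < c & forall p, 0 <= p ->
    c * r `^ (p + 1) <= power_integral p g.
  apply: (power_integral_lower cg tl (ltW r0)).
  by rewrite -aE -gaE ger0_norm ?(ltW m0) // /r gtr_pMr // gtrBl.
(* Chosen so that r^2 s = 1 / (1 - eps) > 1: then the power (r^2 s)^((p+1)/2) beats
   every constant, while D(g) s = 1 / (m (1 - eps)^3) is close to 1 / m. *)
pose s := (m ^+ 2 * (1 - eps) ^+ 3)^-1.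
have s0 : 0 < s by rewrite invr_gt0 mulr_gt0 ?exprn_gt0.
have b1 : 1 < (1 - eps)^-1 by rewrite invf_gt1 // gtrBl.
have [P PP] := powR_large (m * s / c) b1.
exists (Num.max 1 (2 * P)) => p; rewrite gt_max => /andP[p1 pP].
have [p0 pq] : 0 <= p /\ P < (p + 1) / 2 by split; lra.
have -> : (green a a * (1 - eps) ^+ 3)^-1 = dirichlet g g * s.
  by rewrite Dg /s -/m; field; rewrite !gt_eqF.
apply: (least_energy_solution_bound Gdeg p1 (hu p1)) => //.
  by move=> g0; move: m0; rewrite gaE g0 ltxx.
apply: (@le_trans _ _ (c * r `^ (p + 1) * s `^ ((p - 1) / 2))); last first.
  by rewrite ler_wpM2r ?powR_ge0 // cP.
pose q := (p + 1) / 2.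
have rE : r `^ (p + 1) = (r ^+ 2) `^ q.
  by rewrite -powR_mulrn ?(ltW r0) // -powRrM; congr (_ `^ _); rewrite /q; field.
have sE : s `^ ((p - 1) / 2) = s `^ q / s.
  have -> : (p - 1) / 2 = q - 1 by rewrite /q; field.
  by rewrite -(powR_predM q s0) mulfK // gt_eqF.
rewrite rE sE -mulrA [_ * (_ / s)]mulrA -powRM ?sqr_ge0 ?(ltW s0) //.
have -> : r ^+ 2 * s = (1 - eps)^-1 by rewrite /r /s; field; rewrite !gt_eqF.
rewrite mulrA ler_pdivlMr // -ler_pdivrMl // mulrC Dg -/m.
by apply/ltW/PP.
Qed.

(** From U^2 <= G(x_p, x_p) D(u_p), the lower bound for U and the upper bound for
    D(u_p) one gets G(x_p, x_p) > m (1 - eps)^4. *)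
Lemma green_maximum_point_liminf (delta : R) : 0 < delta ->
  exists P : R, forall p, P < p -> green a a - delta < green (x p) (x p).
Proof.
move=> delta0; have m0 := green_argmax_gt0; set m := green a a in m0 *.
pose eps := Num.min 2^-1 (delta / (8 * m)).
have d8 : 0 < delta / (8 * m) by rewrite divr_gt0 // mulr_gt0.
have eps0 : 0 < eps by rewrite lt_min d8 invr_gt0 ltr0n.
have epsh : eps <= 2^-1 by rewrite ge_min lexx.
have epsm : eps * (8 * m) <= delta.
  by rewrite -ler_pdivlMr ?mulr_gt0 // ge_min lexx orbT.
have epsI : 0 < eps < 1 by rewrite eps0 (le_lt_trans epsh) // invf_lt1 // ltr1n.
have [P1 H1] := maximum_liminf epsI; have [P2 H2] := dirichlet_limsup epsI.
exists (Num.max 1 (Num.max P1 P2)) => p; rewrite !gt_max => /and3P[p1 pP1 pP2].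
have e1 : 0 < 1 - eps by rewrite subr_gt0; case/andP: epsI.
have D0 := solution_dirichlet_gt0 p1.
have U1 := H1 p pP1; have D1 := H2 p pP2; have U2 := maximum_sqr_bound p1.
have U3 : 1 - eps < green (x p) (x p) * (m * (1 - eps) ^+ 3)^-1.
  apply: (lt_le_trans U1); apply: (le_trans U2); apply: ler_wpM2l => //.
  by rewrite -(pmulr_lge0 _ D0) (le_trans (sqr_ge0 _) U2).
rewrite ltr_pdivlMr in U3; last by rewrite mulr_gt0 ?exprn_gt0.
apply: le_lt_trans U3.
exact: quartic_loss.
Qed.

End Concentration.

Theorem theorem2 (R : realType) (G : metric_graph R)
    (Gconn : connected_graph G)
    (Gdeg : forall v : vertex G, degree v != 2%N)
    (Gend : exists v : vertex G, Vend v)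
    (u : R -> gpoint G -> R) (x : R -> gpoint G)
    (hu : forall p : R, 1 < p -> least_energy_solution p (u p))
    (hx : forall p : R, 1 < p -> maximum_point (u p) (x p)) :
  (dist_set (x p) (green_argmax G) @[p --> +oo] --> 0%E) /\
  (forall a : gpoint G, green_argmax G = [set a] ->
     dist (x p) a @[p --> +oo] --> (0 : R)).
Proof.
have [a aM] := green_argmax_nonempty Gconn Gend.
have near_argmax (eps : R) : 0 < eps ->
    \forall p \near +oo, exists2 b, green_argmax G b & dist (x p) b < eps.
  move=> eps0; have [d d0 far] := green_far_from_argmax Gconn Gend aM eps0.
  have [P PP] := green_maximum_point_liminf Gconn Gdeg Gend hu hx aM d0.
  apply: filterS (nbhs_pinfty_gt (num_real P)) => p pP.
  apply: contrapT => no; have := PP p pP; rewrite ltNge => /negP; apply; apply: far => b bM.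
  by rewrite leNgt; apply/negP => xb; apply: no; exists b.
have ds_ge0 p : (0%R <= dist_set (x p) (green_argmax G))%E.
  by apply: le_ereal_inf_tmp => _ [b _ <-]; rewrite lee_fin dist_ge0.
have ds_le (eps : R) : 0 < eps ->
    \forall p \near +oo, (dist_set (x p) (green_argmax G) <= eps%:E)%E.
  move=> /near_argmax; apply: filterS => p [b bM xb].
  apply: (@le_trans _ _ (dist (x p) b)%:E); last by rewrite lee_fin ltW.
  by apply: ereal_inf_lbound; exists b.
have fin (eps : R) p : (dist_set (x p) (green_argmax G) <= eps%:E)%E ->
    dist_set (x p) (green_argmax G) \is a fin_num.
  by move=> h; rewrite ge0_fin_numE // (le_lt_trans h) // ltry.
split.
  apply/fine_cvgP; split; first by apply: filterS (ds_le 1 ltr01) => p; exact: fin.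
  apply/cvgrPdist_le => eps eps0; apply: filterS (ds_le eps eps0) => p h.
  rewrite sub0r normrN /= ger0_norm; last exact: fine_ge0.
  by rewrite -lee_fin fineK // (fin _ _ h).
move=> b bE; apply/cvgrPdist_le => eps eps0.
apply: filterS (near_argmax eps eps0) => p [c]; rewrite bE => -> xb.
by rewrite sub0r normrN ger0_norm ?dist_ge0 // ltW.
Qed.
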